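(* Let $N$ be a natural number, let $p\in\mathbb{C}$, $p\neq 0$, let $L_1,\dots,L_n$ be irreducible (highest weight) $gl(N)$-modules, and let $l\in\mathbb{Z}_{\ge 0}$. For $z=(z_1,\dots,z_n)\in\mathbb{C}^n$ let $C(z)\subseteq (L_1\otimes\cdots\otimes L_n)^{sing}_l$ be the subspace of quantized conformal blocks, that is: - if $(L_1\otimes\cdots\otimes L_n)^{sing}_l$ is a resonance subspace, i.e. for some $k\in\mathbb{N}=\{1,2,\dots\}$, $k\le l$, one has $2h_\theta+(p+N+k-1)\,\mathrm{Id}=0$ in $(L_1\otimes\cdots\otimes L_n)^{sing}_l$, then $$C(z)=\{m\in (L_1\otimes\cdots\otimes L_n)^{sing}_l \;|\; (e(z))^k m=0\};$$ - otherwise $C(z)=(L_1\otimes\cdots\otimes L_n)^{sing}_l$. Then the space of conformal blocks $C(z)$ is invariant with respect to the qKZ connection, $$K_i(z)\,C(z)=C(z_1,\dots,z_i+p,\dots,z_n),\qquad i=1,\dots,n,$$ as well as with respect to permutations of variables, $$P\,R_{L_iL_{i+1}}(z_i-z_{i+1})\,C(z)=C(z_1,\dots,z_{i+1},z_i,\dots,z_n),\qquad i=1,\dots,n-1.$$ Here $P$ exchanges the $i$-th and $(i+1)$-st tensor factors, and the right-hand side of the last formula is the subspace of quantized conformal blocks in $(L_1\otimes\cdots\otimes L_{i+1}\otimes L_i\otimes\cdots\otimes L_n)^{sing}_l$ defined with the evaluation points $(z_1,\dots,z_{i+1},z_i,\dots,z_n)$.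
   Context: **Lie algebra.** $gl(N)$ has basis $e_{ij}$, $i,j=1,\dots,N$, with $[e_{ij},e_{kl}]=\delta_{jk}e_{il}-\delta_{il}e_{kj}$. Set $h_i=\tfrac12 e_{ii}$, $h_\theta=h_1-h_N$, $e_\theta=e_{1N}$. The irreducible module $L$ with highest weight $\lambda=(\lambda_{(1)},\dots,\lambda_{(N)})\in\mathbb{C}^N$ is the irreducible quotient of the Verma module generated by $v$ with $h_iv=\lambda_{(i)}v$ and $e_{ij}v=0$ for $i<j$. For $M=L_1\otimes\cdots\otimes L_n$, where $L_i$ has highest weight $\lambda_i$, put $\lambda=\lambda_1+\dots+\lambda_n$ and $$M^{sing}=\{m\in M\,|\,e_{i,i+1}m=0,\ i=1,\dots,N-1\},$$ $$(M)_l=\{m\in M\,|\,h_\theta m=(\lambda_{(1)}-\lambda_{(N)}-l)m\},\qquad (M)^{sing}_l=(M)_l\cap M^{sing}.$$ **Yangian.** $Y(gl(N))$ is the associative algebra with generators $T_{ij}^{(s)}$, $i,j=1,\dots,N$, $s=0,1,2,\dots$, and relations $T^{(0)}_{ij}=\delta_{ij}$, $$[T_{ij}^{(r)},T_{kl}^{(s+1)}]-[T_{ij}^{(r+1)},T_{kl}^{(s)}]=T_{kj}^{(r)}T_{il}^{(s)}-T_{kj}^{(s)}T_{il}^{(r)},\qquad r,s\ge 0.$$ The comultiplication is $\Delta(T_{ij}^{(s)})=\sum_{k=1}^N\sum_{r=0}^s T_{ik}^{(r)}\otimes T_{kj}^{(s-r)}$. For a $gl(N)$-module $M$ and $x\in\mathbb{C}$,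 the evaluation module $M(x)$ is $M$ with the action $T_{ij}^{(s)}m=x^{s-1}e_{ji}m$ for $s\ge1$. **The operator $e(z)$.** $e(z)$ is the operator on $L_1\otimes\cdots\otimes L_n$ by which the element $T_{N1}^{(2)}-T_{NN}^{(1)}T_{N1}^{(1)}\in Y(gl(N))$ acts on the $Y(gl(N))$-module $L_1(z_1)\otimes\cdots\otimes L_n(z_n)$. Explicitly, with $e_{ij}^{(s)}$, $h_\theta^{(s)}$, $e_\theta^{(s)}$ denoting the corresponding elements acting on the $s$-th factor, $$e(z)=\sum_{j=1}^n\Big(z_j-e_{NN}^{(j)}+\sum_{s=j+1}^n 2h_\theta^{(s)}\Big)e_\theta^{(j)}+\sum_{j=2}^{N-1}\ \sum_{1\le r<s\le n}e_{jN}^{(r)}e_{1j}^{(s)}.$$ **Rational $R$-matrix.** Let $L_1,L_2$ be irreducible highest weight $gl(N)$-modules with highest weight vectors $v_1,v_2$. For generic $x,y\in\mathbb{C}$ the $Y(gl(N))$-modules $L_1(x)\otimes L_2(y)$ and $L_2(y)\otimes L_1(x)$ are irreducible and isomorphic, and there is a unique intertwiner $L_1(x)\otimes L_2(y)\to L_2(y)\otimes L_1(x)$ of the form $P R_{L_1L_2}(x-y)$ sending $v_1\otimes v_2$ to $v_2\otimes v_1$, where $P(a\otimes b)=b\otimes a$. The operator $R_{L_1L_2}(x)\in \mathrm{End}(L_1\otimes L_2)$ is called the rational $R$-matrix; it commutes with the action of $gl(N)$ in $L_1\otimes L_2$. **qKZ operators.** For $m=1,\dots,n$, $K_m(z)\in\mathrm{End}(L_1\otimes\cdots\otimes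 L_n)$ is $$K_m(z)=R_{L_mL_{m-1}}(z_m-z_{m-1}+p)\cdots R_{L_mL_1}(z_m-z_1+p)\;R_{L_mL_n}(z_m-z_n)\cdots R_{L_mL_{m+1}}(z_m-z_{m+1}),$$ where $R_{L_mL_j}(x)$ acts on the $m$-th and $j$-th tensor factors. These operators define the discrete quantized Knizhnik–Zamolodchikov (qKZ) connection on the trivial vector bundle over $\mathbb{C}^n$ with fiber $L_1\otimes\cdots\otimes L_n$. *)

(* Defs.v *)
From HB Require Import structures.
From mathcomp Require Import all_boot all_order all_algebra.
From mathcomp Require Import perm.
From mathcomp Require Import boolp classical_sets functions reals complex.

Set Implicit Arguments.
Unset Strict Implicit.
Unset Printing Implicit Defensive.
Import Order.TTheory GRing.Theory Num.Theory.
Local Open Scope ring_scope.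
Local Open Scope quotient_scope.

Section Tensor.
Variables (F : fieldType) (I : eqType) (V : I -> lmodType F).

Definition multilinear (W : lmodType F) (f : (forall i, V i) -> W) : Prop :=
  forall (v : forall i, V i) (i : I), linear (fun x : V i => f (dfwith v x)).

Definition fsum : Type := seq (F * (forall i, V i)).
HB.instance Definition _ := Choice.on fsum.

Definition feval (W : lmodType F) (f : (forall i, V i) -> W) (s : fsum) : W :=
  \sum_(c <- s) c.1 *: f c.2.

(* Two formal sums of pure tensors denote the same tensor when no multilinear
   map separates them.  The quotient has the universal property of the tensor
   product: [tpure_multilinear], [tlift_linear], [tlift_pure], [tens_ext]. *)
Definition teq (s t : fsum) : bool :=
  `[< forall (W : lmodType F) (f : (forall i, V i) -> W),
        multilinear f -> feval f s = feval f t >].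

Lemma teq_refl : reflexive teq.
Proof. by move=> s; apply/asboolP. Qed.
Lemma teq_sym : symmetric teq.
Proof.
by move=> s t; apply/idP/idP => /asboolP h; apply/asboolP => W f /h ->.
Qed.
Lemma teq_trans : transitive teq.
Proof.
by move=> s t u /asboolP h /asboolP h'; apply/asboolP => W f fM; rewrite h // h'.
Qed.
Canonical teq_equiv := EquivRel teq teq_refl teq_sym teq_trans.

Definition tens : Type := {eq_quot teq_equiv}.
HB.instance Definition _ := Choice.on tens.

Definition tclass (s : fsum) : tens := \pi_({eq_quot teq_equiv}) s.
Definition trepr (t : tens) : fsum := repr (t : {eq_quot teq_equiv}).

Lemma treprK t : tclass (trepr t) = t.
Proof. exact: (@reprK _ {eq_quot teq_equiv}). Qed.

Lemma tclassP s t :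
  (forall (W : lmodType F) (f : (forall i, V i) -> W),
     multilinear f -> feval f s = feval f t) <-> tclass s = tclass t.
Proof.
split=> [h|/eqP]; last by rewrite /tclass eqmodE => /asboolP.
by apply/eqP; rewrite /tclass eqmodE; apply/asboolP.
Qed.

Lemma feval_repr s (W : lmodType F) (f : (forall i, V i) -> W) :
  multilinear f -> feval f (trepr (tclass s)) = feval f s.
Proof. by move=> fM; apply: (tclassP _ _).2 fM; rewrite treprK. Qed.

Definition fscale (a : F) (s : fsum) : fsum := [seq (a * c.1, c.2) | c <- s].

Lemma feval_cat (W : lmodType F) (f : (forall i, V i) -> W) (s t : fsum) :
  feval f (s ++ t) = feval f s + feval f t.
Proof. by rewrite /feval big_cat. Qed.

Lemma feval_scale (W : lmodType F) (f : (forall i, V i) -> W) a (s : fsum) :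
  feval f (fscale a s) = a *: feval f s.
Proof.
rewrite /feval big_map scaler_sumr; apply: eq_bigr => c _ /=.
by rewrite scalerA.
Qed.

Definition tadd (x y : tens) : tens := tclass (trepr x ++ trepr y).
Definition tscale (a : F) (x : tens) : tens := tclass (fscale a (trepr x)).
Definition tzero : tens := tclass [::].
Definition topp (x : tens) : tens := tscale (-1) x.

Lemma tens_eq (x y : tens) :
  (forall (W : lmodType F) (f : (forall i, V i) -> W),
     multilinear f -> feval f (trepr x) = feval f (trepr y)) -> x = y.
Proof. by move=> h; rewrite -(treprK x) -(treprK y); apply/tclassP. Qed.

Lemma taddA : associative tadd.
Proof.
move=> x y z; apply: tens_eq => W f fM.
by rewrite !(feval_repr, feval_cat)// addrA.
Qed.
Lemma taddC : commutative tadd.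
Proof.
move=> x y; apply: tens_eq => W f fM.
by rewrite !(feval_repr, feval_cat)// addrC.
Qed.
Lemma tadd0 : left_id tzero tadd.
Proof.
move=> x; apply: tens_eq => W f fM.
by rewrite !(feval_repr, feval_cat)// {1}/feval big_nil add0r.
Qed.
Lemma taddN : left_inverse tzero topp tadd.
Proof.
move=> x; apply: tens_eq => W f fM.
rewrite !(feval_repr, feval_cat)// feval_scale scaleN1r addNr.
by rewrite /feval big_nil.
Qed.
HB.instance Definition _ := GRing.isZmodule.Build tens taddA taddC tadd0 taddN.

Lemma tscaleA a b x : tscale a (tscale b x) = tscale (a * b) x.
Proof.
apply: tens_eq => W f fM.
by rewrite !(feval_repr, feval_scale)// scalerA.
Qed.
Lemma tscale1 : left_id 1 tscale.
Proof.
move=> x; apply: tens_eq => W f fM.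
by rewrite !(feval_repr, feval_scale)// scale1r.
Qed.
Lemma tscaleDr : right_distributive tscale +%R.
Proof.
move=> a x y; apply: tens_eq => W f fM.
by rewrite !(feval_repr, feval_scale, feval_cat)// scalerDr.
Qed.
Lemma tscaleDl x : {morph tscale^~ x : a b / a + b}.
Proof.
move=> a b; apply: tens_eq => W f fM.
by rewrite !(feval_repr, feval_scale, feval_cat)// scalerDl.
Qed.
HB.instance Definition _ :=
  GRing.Zmodule_isLmodule.Build F tens tscaleA tscale1 tscaleDr tscaleDl.

Definition tpure (v : forall i, V i) : tens := tclass [:: (1, v)].

(* Meaningful for multilinear [f] only, in which case the value does not depend
   on the representative of [t]. *)
Definition tlift (W : lmodType F) (f : (forall i, V i) -> W) (t : tens) : W :=
  feval f (trepr t).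

Lemma tlift_linear (W : lmodType F) (f : (forall i, V i) -> W) :
  multilinear f -> linear (tlift f).
Proof.
move=> fM a x y; rewrite /tlift.
by rewrite !(feval_repr, feval_scale, feval_cat).
Qed.

Lemma feval1 (W : lmodType F) (f : (forall i, V i) -> W) v :
  feval f [:: (1, v)] = f v.
Proof. by rewrite /feval big_seq1 scale1r. Qed.

Lemma tlift_pure (W : lmodType F) (f : (forall i, V i) -> W) v :
  multilinear f -> tlift f (tpure v) = f v.
Proof. by move=> fM; rewrite /tlift feval_repr // feval1. Qed.

Lemma tpure_multilinear : multilinear tpure.
Proof.
move=> v i a x y; apply: tens_eq => W f fM.
by rewrite !(feval_repr, feval_scale, feval_cat, feval1)// fM.
Qed.

Lemma tens_sum (t : tens) : t = \sum_(c <- trepr t) c.1 *: tpure c.2.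
Proof.
apply: tens_eq => W f fM; have lf := tlift_linear fM.
pose g := GRing.isLinear.Build _ _ _ _ _ lf.
pose G : {linear tens -> W} := HB.pack (tlift f) g.
rewrite -/(tlift f t) -/(G _) [in RHS]/feval.
transitivity (\sum_(c <- trepr t) c.1 *: f c.2); first by [].
rewrite -[RHS]/(G (\sum_(c <- trepr t) c.1 *: tpure c.2)) linear_sum.
by apply: eq_bigr => c _; rewrite linearZ /= tlift_pure.
Qed.

Lemma tens_ext (W : lmodType F) (f g : tens -> W) :
  linear f -> linear g -> (forall v, f (tpure v) = g (tpure v)) -> f =1 g.
Proof.
move=> lf lg fg t.
pose f' : {linear tens -> W} := HB.pack f (GRing.isLinear.Build _ _ _ _ _ lf).
pose g' : {linear tens -> W} := HB.pack g (GRing.isLinear.Build _ _ _ _ _ lg).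
rewrite -[f t]/(f' t) -[g t]/(g' t) (tens_sum t) !linear_sum.
by apply: eq_bigr => c _; rewrite !linearZ /= fg.
Qed.

End Tensor.

Section LinearFacts.
Variables (F : fieldType) (U W : lmodType F) (f : U -> W).
Hypothesis lf : linear f.
Let f' : {linear U -> W} := HB.pack f (GRing.isLinear.Build _ _ _ _ _ lf).

Lemma lin0 : f 0 = 0. Proof. exact: (linear0 f'). Qed.
Lemma linD x y : f (x + y) = f x + f y. Proof. exact: (linearD f'). Qed.
Lemma linB x y : f (x - y) = f x - f y. Proof. exact: (linearB f'). Qed.
Lemma linZ a x : f (a *: x) = a *: f x. Proof. exact: (linearZ_LR f'). Qed.
Lemma linS (J : Type) (s : seq J) (P : pred J) (g : J -> U) :
  f (\sum_(j <- s | P j) g j) = \sum_(j <- s | P j) f (g j).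
Proof. exact: (linear_sum f'). Qed.
End LinearFacts.

Lemma lin_scale (F : fieldType) (U : lmodType F) a :
  linear (fun x : U => a *: x).
Proof. by move=> b x y; rewrite scalerDr !scalerA mulrC. Qed.

Lemma lin_comp (F : fieldType) (U V W : lmodType F) (g : V -> W) (f : U -> V) :
  linear g -> linear f -> linear (fun x => g (f x)).
Proof. by move=> lg lf a x y; rewrite lf lg. Qed.

Lemma lin_sum (F : fieldType) (U W : lmodType F) (J : Type) (s : seq J)
    (f : J -> U -> W) :
  (forall j, linear (f j)) -> linear (fun x => \sum_(j <- s) f j x).
Proof.
move=> lf a x y; rewrite scaler_sumr -big_split; apply: eq_bigr => j _.
exact: lf.
Qed.

Section Dfwith.
Variables (I : eqType) (V : I -> Type).
Implicit Type v : forall i, V i.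

Lemma dfwith_same v i (x y : V i) : dfwith (dfwith v x) y = dfwith v y.
Proof.
apply: functional_extensionality_dep => j.
by have [<-|ij] := eqVneq i j; rewrite ?dfwith_in // !dfwith_out.
Qed.

Lemma dfwith_swap v i j (x : V i) (y : V j) : i != j ->
  dfwith (dfwith v x) y = dfwith (dfwith v y) x.
Proof.
move=> ij; apply: functional_extensionality_dep => k.
have [ik|ik] := eqVneq i k.
  by case: _ / ik; rewrite dfwith_out 1?eq_sym // !dfwith_in.
rewrite [RHS]dfwith_out //; have [jk|jk] := eqVneq j k.
  by case: _ / jk; rewrite !dfwith_in.
by rewrite !dfwith_out.
Qed.

Lemma dfwith_id v i : dfwith v (v i) = v.
Proof.
apply: functional_extensionality_dep => j.
by have [<-|ij] := eqVneq i j; rewrite ?dfwith_in // !dfwith_out.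
Qed.
End Dfwith.

Section Factor.
Variables (F : fieldType) (I : eqType) (V : I -> lmodType F).

Definition at_ (k : I) (g : V k -> V k) (t : tens V) : tens V :=
  tlift (fun v => tpure (dfwith v (g (v k)))) t.

Lemma at_multilinear k (g : V k -> V k) : linear g ->
  multilinear (fun v : forall i, V i => tpure (dfwith v (g (v k)))).
Proof.
move=> lg v i; have [ik|ik] := eqVneq i k.
  case: _ / ik g lg => g lg a x y.
  by rewrite !dfwith_same !dfwith_in lg tpure_multilinear.
move=> a x y; rewrite !(dfwith_out _ _ ik).
by rewrite !(dfwith_swap _ _ _ ik) tpure_multilinear.
Qed.

Lemma at_linear k (g : V k -> V k) : linear g -> linear (at_ g).
Proof. by move=> lg; apply/tlift_linear/at_multilinear. Qed.

Lemma at_pure k (g : V k -> V k) v : linear g ->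
  at_ g (tpure v) = tpure (dfwith v (g (v k))).
Proof. by move=> lg; apply/tlift_pure/at_multilinear. Qed.

Lemma at_comp k (g h : V k -> V k) t : linear g -> linear h ->
  at_ g (at_ h t) = at_ (fun x => g (h x)) t.
Proof.
move=> lg lh; apply: (@tens_ext _ _ _ _ (fun t => at_ g (at_ h t))).
- by apply: lin_comp; apply: at_linear.
- by apply/at_linear/lin_comp.
move=> v; rewrite !at_pure //; last exact: lin_comp.
by rewrite dfwith_same dfwith_in.
Qed.

Lemma at_comm k l (g : V k -> V k) (h : V l -> V l) t : k != l ->
  linear g -> linear h -> at_ g (at_ h t) = at_ h (at_ g t).
Proof.
move=> kl lg lh; apply: (@tens_ext _ _ _ _ (fun t => at_ g (at_ h t))
  (fun t => at_ h (at_ g t))); try by apply: lin_comp; apply: at_linear.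
move=> v; rewrite !at_pure // !dfwith_out // 1?eq_sym //.
by rewrite dfwith_swap // eq_sym.
Qed.

Lemma at_lincomb k (a b : F) (g h : V k -> V k) t : linear g -> linear h ->
  at_ (fun x => a *: g x + b *: h x) t = a *: at_ g t + b *: at_ h t.
Proof.
move=> lg lh.
have lgh : linear (fun x => a *: g x + b *: h x).
  by move=> c x y; rewrite lg lh !scalerDr !scalerA !(mulrC c) addrACA.
apply: (@tens_ext _ _ _ _ _ (fun t => a *: at_ g t + b *: at_ h t)).
- exact: at_linear.
- move=> c x y; rewrite !at_linear // !scalerDr !scalerA !(mulrC c).
  by rewrite addrACA.
move=> v; rewrite !at_pure // tpure_multilinear; congr (_ + _).
exact: (linZ (tpure_multilinear v (i := k))).
Qed.

Lemma at_scale k (a : F) t : at_ (fun x : V k => a *: x) t = a *: t.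
Proof.
apply: (@tens_ext _ _ _ _ _ (fun t => a *: t)).
- exact/at_linear/lin_scale.
- exact: lin_scale.
move=> v; rewrite at_pure; last exact: lin_scale.
by rewrite (linZ (tpure_multilinear v (i := k))) dfwith_id.
Qed.

End Factor.
Arguments at_ {F I} V k g t.

Record glmod (F : fieldType) (N : nat) := GlMod {
  gl_car :> lmodType F;
  gl_e : 'I_N -> 'I_N -> gl_car -> gl_car;
  gl_linear : forall i j, linear (gl_e i j);
  gl_bracket : forall i j k l v,
    gl_e i j (gl_e k l v) - gl_e k l (gl_e i j v) =
    (j == k)%:R *: gl_e i l v - (i == l)%:R *: gl_e k j v }.

Definition gl_h (F : fieldType) (N : nat) (M : glmod F N) (i : 'I_N) (v : M) : M :=
  2^-1 *: gl_e i i v.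

Definition subspace (F : fieldType) (V : lmodType F) (U : set V) : Prop :=
  U 0 /\ forall a u v, U u -> U v -> U (a *: u + v).

(* An irreducible gl(N)-module with a nonzero vector of weight [hw_wt] killed by
   the e_ij, i < j, i.e. the irreducible quotient of the Verma module; weights
   are taken with respect to h_i = e_ii / 2. *)
Record hwmod (F : fieldType) (N : nat) := HwMod {
  hw_car :> glmod F N;
  hw_wt : 'I_N -> F;
  hw_vec : hw_car;
  hw_vec_neq0 : hw_vec != 0;
  hw_weight : forall i, gl_h i hw_vec = hw_wt i *: hw_vec;
  hw_raise : forall i j : 'I_N, (i < j)%N -> gl_e i j hw_vec = 0;
  hw_irr : forall U : set hw_car, subspace U ->
    (forall i j v, U v -> U (gl_e i j v)) ->
    (forall v, U v -> v = 0) \/ (forall v, U v) }.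

Section GlTensor.
Variables (F : fieldType) (N n : nat) (M : 'I_n -> glmod F N).

Definition gl_tens_e (i j : 'I_N) (t : tens M) : tens M :=
  \sum_k at_ M k (@gl_e _ _ (M k) i j) t.

Lemma gl_tens_linear i j : linear (gl_tens_e i j).
Proof. by apply: lin_sum => k; apply/at_linear/gl_linear. Qed.

Lemma gl_tens_bracket i j k l v :
  gl_tens_e i j (gl_tens_e k l v) - gl_tens_e k l (gl_tens_e i j v) =
  (j == k)%:R *: gl_tens_e i l v - (i == l)%:R *: gl_tens_e k j v.
Proof.
have lE c i' j' : linear (at_ M c (@gl_e _ _ (M c) i' j')).
  by apply/at_linear/gl_linear.
rewrite /gl_tens_e.
under eq_bigr => c _ do rewrite (linS (lE c i j)).
under [X in _ - X]eq_bigr => c _ do rewrite (linS (lE c k l)).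
rewrite [X in _ - X]exchange_big -sumrB !scaler_sumr -sumrB.
apply: eq_bigr => c _; rewrite -sumrB (bigD1 c) //= big1 ?addr0; last first.
  by move=> d dc; apply/eqP; rewrite subr_eq0 at_comm //;
     [rewrite eq_sym | apply: gl_linear | apply: gl_linear].
have lin2 i' j' k' l' : linear (fun x => gl_e i' j' (@gl_e _ _ (M c) k' l' x)).
  by apply: lin_comp; apply: gl_linear.
rewrite !at_comp; try exact: gl_linear.
rewrite -[X in X - _]scale1r -[X in _ - X]scale1r -!scaleNr.
rewrite -!at_lincomb; try exact: lin2; try exact: gl_linear.
congr (at_ M c _ v); apply: functional_extensionality_dep => x.
by rewrite scale1r !scaleNr scale1r gl_bracket.
Qed.

Definition gl_tens : glmod F N := GlMod gl_tens_linear gl_tens_bracket.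

End GlTensor.

(* An action of Y(gl(N)) is the same as a family of operators satisfying the
   defining relations of the generators T_ij^(s). *)
Definition yangian_action (F : fieldType) (N : nat) (V : lmodType F)
    (T : 'I_N -> 'I_N -> nat -> V -> V) : Prop :=
  [/\ forall i j s, linear (T i j s),
      forall i j v, T i j 0 v = (i == j)%:R *: v
    & forall i j k l r s v,
        (T i j r (T k l s.+1 v) - T k l s.+1 (T i j r v))
        - (T i j r.+1 (T k l s v) - T k l s (T i j r.+1 v))
        = T k j r (T i l s v) - T k j s (T i l r v)].

Record ymod (F : fieldType) (N : nat) := YMod {
  y_car :> lmodType F;
  y_T : 'I_N -> 'I_N -> nat -> y_car -> y_car;
  y_action : yangian_action y_T }.

Section Evaluation.
Variables (F : fieldType) (N : nat) (M : glmod F N) (x : F).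

Definition ev_T (i j : 'I_N) (s : nat) (v : M) : M :=
  if s is s'.+1 then x ^+ s' *: gl_e j i v else (i == j)%:R *: v.

Lemma ev_action : yangian_action ev_T.
Proof.
have lE := @gl_linear _ _ M.
split=> //.
- move=> i j [|s] /=; first exact: lin_scale.
  exact: (lin_comp (lin_scale _) (lE _ _)).
move=> i j k l [|r] [|s] v /=; rewrite ?expr0 ?scale1r !(linZ (lE _ _)).
- by rewrite !subrr.
- rewrite !scalerA (mulrC (x ^+ s.+1)) subrr sub0r -scalerBr gl_bracket.
  rewrite (eq_sym k j) -(scalerN (x ^+ s)) opprB scalerBr !scalerA.
  by rewrite ![x ^+ s * _]mulrC.
- rewrite !scalerA (mulrC (x ^+ r.+1)) subrr subr0 -scalerBr gl_bracket.
  rewrite (eq_sym k j) scalerBr !scalerA.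
  by rewrite ![x ^+ r * _]mulrC.
rewrite !scalerA (mulrC (x ^+ s.+1)) (mulrC (x ^+ s)) (mulrC (x ^+ s)).
by rewrite -!exprD addSnnS !subrr.
Qed.

Definition yev : ymod F N := YMod ev_action.

End Evaluation.

Section Convolution.
Variable V : zmodType.
Implicit Type G : nat -> nat -> nat -> nat -> V.

Definition conv2 G (r s : nat) : V :=
  \sum_(p < r.+1) \sum_(q < s.+1) G p q (r - p)%N (s - q)%N.

Lemma conv2_shiftl G r s :
  (forall q r' s', G 0%N q r' s' = 0) -> (forall p r' s', G p 0%N r' s' = 0) ->
  conv2 G r s.+1 - conv2 G r.+1 s =
  conv2 (fun p q r' s' => G p q.+1 r' s' - G p.+1 q r' s') r s.
Proof.
move=> G0 G0'; rewrite /conv2 [X in _ - X]big_ord_recl /=.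
rewrite [X in _ - (X + _)]big1 // add0r -sumrB; apply: eq_bigr => p _.
by rewrite big_ord_recl /= G0' add0r -sumrB; apply: eq_bigr => q _.
Qed.

Lemma conv2_shiftr G r s :
  (forall p q s', G p q 0%N s' = 0) -> (forall p q r', G p q r' 0%N = 0) ->
  conv2 G r s.+1 - conv2 G r.+1 s =
  conv2 (fun p q r' s' => G p q r' s'.+1 - G p q r'.+1 s') r s.
Proof.
move=> G0 G0'; rewrite /conv2 [X in _ - X]big_ord_recr /=.
rewrite [X in _ - (_ + X)]big1 ?addr0 => [|q _]; last by rewrite subnn G0.
rewrite -sumrB; apply: eq_bigr => p _.
rewrite big_ord_recr /= subnn G0' addr0 -sumrB; apply: eq_bigr => q _.
by rewrite !subSn // -ltnS ltn_ord.
Qed.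

Lemma conv2D G H r s :
  conv2 G r s + conv2 H r s = conv2 (fun p q r' s' => G p q r' s' + H p q r' s') r s.
Proof. by rewrite -big_split; apply: eq_bigr => p _; rewrite -big_split. Qed.

Lemma conv2B G H r s :
  conv2 G r s - conv2 H r s = conv2 (fun p q r' s' => G p q r' s' - H p q r' s') r s.
Proof. by rewrite -sumrB; apply: eq_bigr => p _; rewrite -sumrB. Qed.

Lemma eq_conv2 G H r s :
  (forall p q r' s', G p q r' s' = H p q r' s') -> conv2 G r s = conv2 H r s.
Proof. by move=> GH; apply: eq_bigr => p _; apply: eq_bigr => q _. Qed.

Lemma conv2_swap G r s :
  conv2 G r s = conv2 (fun p q r' s' => G q p s' r') s r.
Proof. exact: exchange_big. Qed.
End Convolution.

Section Coproduct.
Variables (F : fieldType) (N : nat) (V : lmodType F).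
Implicit Types A B : 'I_N -> 'I_N -> nat -> V -> V.

(* The action prescribed by the comultiplication, for two commuting actions. *)
Definition coprod_T A B (i j : 'I_N) (s : nat) (v : V) : V :=
  \sum_k \sum_(r < s.+1) A i k r (B k j (s - r)%N v).

Lemma coprod_action A B :
  (forall i j r k l s v, A i j r (B k l s v) = B k l s (A i j r v)) ->
  yangian_action A -> yangian_action B -> yangian_action (coprod_T A B).
Proof.
move=> AB [lA A0 relA] [lB B0 relB].
have lT i j s : linear (coprod_T A B i j s).
  by apply: lin_sum => k; apply: lin_sum => r; apply: lin_comp.
have TT i j k l r s v : coprod_T A B i j r (coprod_T A B k l s v) =
  \sum_a \sum_b conv2 (fun p q r' s' =>
    A i a p (A k b q (B a j r' (B b l s' v)))) r s.
  rewrite /coprod_T; apply: eq_bigr => a _.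
  under eq_bigr => p _.
    rewrite (linS (lB _ _ _)) (linS (lA _ _ _)).
    under eq_bigr => b _ do rewrite (linS (lB _ _ _)) (linS (lA _ _ _)).
    over.
  rewrite exchange_big; apply: eq_bigr => b _; apply: eq_bigr => p _.
  by apply: eq_bigr => q _; rewrite -AB.
have TT' i j k l r s v : coprod_T A B k l s (coprod_T A B i j r v) =
  \sum_a \sum_b conv2 (fun p q r' s' =>
    A k b q (A i a p (B b l s' (B a j r' v)))) r s.
  rewrite TT exchange_big; apply: eq_bigr => a _; apply: eq_bigr => b _.
  exact: conv2_swap.
split=> //.
- move=> i j v; rewrite /coprod_T.
  under eq_bigr => k _ do rewrite big_ord1 subnn A0 B0.
  rewrite (bigD1 i) //= eqxx scale1r big1 ?addr0 // => k ki.
  by rewrite eq_sym (negPf ki) scale0r.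
move=> i j k l r s v.
pose G1 (a b : 'I_N) p q r' s' : V :=
  A i a p (A k b q (B a j r' (B b l s' v)))
  - A k b q (A i a p (B a j r' (B b l s' v))).
pose G2 (a b : 'I_N) p q r' s' : V :=
  A k b q (A i a p (B a j r' (B b l s' v)))
  - A k b q (A i a p (B b l s' (B a j r' v))).
have comm r' s' :
    coprod_T A B i j r' (coprod_T A B k l s' v)
    - coprod_T A B k l s' (coprod_T A B i j r' v) =
    \sum_a \sum_b (conv2 (G1 a b) r' s' + conv2 (G2 a b) r' s').
  rewrite TT TT' -sumrB; apply: eq_bigr => a _; rewrite -sumrB.
  apply: eq_bigr => b _; rewrite conv2D conv2B; apply: eq_conv2 => p q u w.
  by rewrite /G1 /G2 addrA subrK.
rewrite !comm -sumrB; under eq_bigr => a _.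
  rewrite -sumrB; under eq_bigr => b _.
    rewrite opprD addrACA conv2_shiftl; first last.
    - by move=> p u w; rewrite /G1 !A0 (linZ (lA _ _ _)) subrr.
    - by move=> q u w; rewrite /G1 !A0 (linZ (lA _ _ _)) subrr.
    rewrite conv2_shiftr; first last.
    - by move=> p q u; rewrite /G2 !B0 (linZ (lB _ _ _)) subrr.
    - by move=> p q u; rewrite /G2 !B0 (linZ (lB _ _ _)) subrr.
    over.
  over.
pose H1 (a b : 'I_N) p q r' s' : V :=
  A k a p (A i b q (B a j r' (B b l s' v))).
pose H2 (a b : 'I_N) p q r' s' : V :=
  A k a q (A i b p (B a j r' (B b l s' v))).
pose H3 (a b : 'I_N) p q r' s' : V :=
  A k b q (A i a p (B b j s' (B a l r' v))).
have E1 a b : conv2 (fun p q r' s' => G1 a b p q.+1 r' s' - G1 a b p.+1 q r' s')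
    r s = conv2 (H1 a b) r s - conv2 (H2 a b) r s.
  by rewrite conv2B; apply: eq_conv2 => p q u w; rewrite /G1 relA.
have E2 a b : conv2 (fun p q r' s' => G2 a b p q r' s'.+1 - G2 a b p q r'.+1 s')
    r s = conv2 (H2 b a) r s - conv2 (H3 a b) r s.
  rewrite conv2B; apply: eq_conv2 => p q u w; rewrite /G2 /H2 /H3.
  by rewrite -!(linB (lA _ _ _)) relB.
under eq_bigr => a _ do under eq_bigr => b _ do rewrite E1 E2.
transitivity (\sum_a \sum_b conv2 (H1 a b) r s - \sum_a \sum_b conv2 (H3 a b) r s).
  under eq_bigr => a _ do rewrite big_split /= !sumrB.
  rewrite big_split /= !sumrB [X in _ + (X - _)]exchange_big /=.
  by rewrite addrA subrK.
congr (_ - _).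
  by rewrite TT.
rewrite TT exchange_big /=; apply: eq_bigr => a _; apply: eq_bigr => b _.
by rewrite conv2_swap.
Qed.

End Coproduct.

Section YTensor.
Variables (F : fieldType) (N n : nat) (Y : 'I_n -> ymod F N).

(* Iterated comultiplication: T_ij^(s) acts on M_1 (x) M' through the sum of
   T_ik^(r) (x) T_kj^(s-r), the action on the empty product being the counit. *)
Fixpoint mono_T (s : seq 'I_n) : 'I_N -> 'I_N -> nat -> tens Y -> tens Y :=
  if s is m :: s' then
    coprod_T (fun i j r => at_ Y m (@y_T _ _ (Y m) i j r)) (mono_T s')
  else fun i j r v => if r is 0 then (i == j)%:R *: v else 0.

Lemma y_linear (M : ymod F N) i j r : linear (@y_T _ _ M i j r).
Proof. by case: (y_action M). Qed.

Lemma at_action m : yangian_action (fun i j r => at_ Y m (@y_T _ _ (Y m) i j r)).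
Proof.
have lT := @y_linear (Y m); case: (y_action (Y m)) => _ T0 rel; split.
- by move=> i j r; apply/at_linear/lT.
- move=> i j v; rewrite -(at_scale m); congr (at_ Y m _ v).
  by apply: functional_extensionality_dep => x; rewrite T0.
move=> i j k l r s v.
have lTT i' j' r' k' l' s' : linear (fun x => y_T i' j' r' (@y_T _ _ (Y m) k' l' s' x)).
  by apply: lin_comp.
have atB g h : linear g -> linear h ->
    at_ Y m g v - at_ Y m h v = at_ Y m (fun x => g x - h x) v.
  move=> lg lh; rewrite -[at_ Y m g v]scale1r -scaleN1r -at_lincomb //.
  congr (at_ Y m _ v); apply: functional_extensionality_dep => x.
  by rewrite scale1r scaleN1r.
have lB (g h : Y m -> Y m) : linear g -> linear h -> linear (fun x => g x - h x).
  by move=> lg lh a x y; rewrite lg lh scalerBr opprD addrACA.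
rewrite !at_comp // !atB //; try by apply: lB.
congr (at_ Y m _ v); apply: functional_extensionality_dep => x.
exact: rel.
Qed.

Lemma mono_comm s m i j r k l u v : m \notin s ->
  at_ Y m (@y_T _ _ (Y m) i j r) (mono_T s k l u v) =
  mono_T s k l u (at_ Y m (@y_T _ _ (Y m) i j r) v).
Proof.
have lT := y_linear.
have laT m' i' j' r' : linear (at_ Y m' (@y_T _ _ (Y m') i' j' r')).
  exact/at_linear/lT.
elim: s k l u v => [|m' s IH] k l u v /=.
  by move=> _; case: u => [|u]; [rewrite (linZ (laT _ _ _ _)) | rewrite (lin0 (laT _ _ _ _))].
rewrite inE negb_or => /andP[mm' ms]; rewrite /coprod_T (linS (laT _ _ _ _)).
apply: eq_bigr => a _; rewrite (linS (laT _ _ _ _)); apply: eq_bigr => b _.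
by rewrite at_comm // IH.
Qed.

Lemma mono_action s : uniq s -> yangian_action (mono_T s).
Proof.
elim: s => [_|m s IH /= /andP[ms us]]; last first.
  apply: coprod_action; [|exact: at_action|exact: IH].
  by move=> i j r k l u v; apply: mono_comm.
split=> //=.
- by move=> i j [|r]; [exact: lin_scale|move=> a x y; rewrite scaler0 addr0].
move=> i j k l [|r] [|s] v; rewrite ?scaler0 ?subrr ?subr0 //.
Qed.

Definition ytens : ymod F N := YMod (mono_action (enum_uniq 'I_n)).

End YTensor.

Definition yev_tens (F : fieldType) (N n : nat) (M : 'I_n -> glmod F N)
    (z : 'I_n -> F) : ymod F N := ytens (fun i => yev (M i) (z i)).

Definition intertwiner (F : fieldType) (N : nat) (Y Z : ymod F N)
    (f : Y -> Z) : Prop :=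
  linear f /\ forall i j s v, f (y_T i j s v) = y_T i j s (f v).

Definition y_irreducible (F : fieldType) (N : nat) (Y : ymod F N) : Prop :=
  (exists v : Y, v != 0) /\
  forall U : set Y, subspace U -> (forall i j s v, U v -> U (y_T i j s v)) ->
    (forall v, U v -> v = 0) \/ (forall v, U v).

Definition y_isomorphic (F : fieldType) (N : nat) (Y Z : ymod F N) : Prop :=
  exists f : Y -> Z, intertwiner f /\ bijective f.

(* Two-fold tensor products are the case ['I_2] of the general ones. *)
Definition fam2 (T : Type) (a b : T) (i : 'I_2) : T :=
  match nat_of_ord i with 0 => a | _ => b end.

Definition pair2 (T : Type) (W : T -> Type) (a b : T) (x : W a) (y : W b)
    (i : 'I_2) : W (fam2 a b i) :=
  match nat_of_ord i as k return W (match k with 0 => a | _ => b end) with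
  | 0 => x
  | _ => y
  end.

Section Binary.
Variables (F : fieldType) (N : nat).
Implicit Types M : glmod F N.

Definition tens2 M1 M2 : lmodType F := tens (fam2 M1 M2).

Definition tpure2 M1 M2 (x : M1) (y : M2) : tens2 M1 M2 :=
  tpure (pair2 (W := @gl_car F N) x y).

Definition flip M1 M2 (t : tens2 M1 M2) : tens2 M2 M1 :=
  tlift (fun w : forall i, fam2 M1 M2 i => tpure2 (w ord_max) (w ord0)) t.

Definition yev2 M1 M2 (x y : F) : ymod F N :=
  yev_tens (fam2 M1 M2) (fam2 x y).

Definition generic M1 M2 (x y : F) : Prop :=
  [/\ y_irreducible (yev2 M1 M2 x y), y_irreducible (yev2 M2 M1 y x)
    & y_isomorphic (yev2 M1 M2 x y) (yev2 M2 M1 y x)].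

Variables L1 L2 : hwmod F N.

Definition is_Rmatrix (u : F) (A : tens2 L1 L2 -> tens2 L1 L2) : Prop :=
  [/\ linear A,
      flip (A (tpure2 (hw_vec L1) (hw_vec L2))) =
        tpure2 (hw_vec L2) (hw_vec L1)
    & forall x y, x - y = u -> generic L1 L2 x y ->
        @intertwiner _ _ (yev2 L1 L2 x y) (yev2 L2 L1 y x)
          (fun t => flip (A t))].

(* R_{L1 L2}(u).  It is uniquely determined by [is_Rmatrix] when u = x - y with
   [generic L1 L2 x y]: an intertwiner killing the product of the highest weight
   vectors vanishes, by irreducibility.  Otherwise its value is irrelevant. *)
Definition Rmatrix (u : F) : tens2 L1 L2 -> tens2 L1 L2 :=
  xget (T := tens2 L1 L2 -> tens2 L1 L2) (fun t => t)
    [set A | is_Rmatrix u A]%classic.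

End Binary.

Section ManyFactors.
Variables (F : fieldType) (N n : nat).

(* [A] acting on the factors [i] and [j] of an n-fold tensor product, its first
   leg on factor [i] and its second leg on factor [j]; see [act2_pure]. *)
Definition ins2 (M : 'I_n -> glmod F N) (i j : 'I_n) (v : forall k, M k)
    (t : tens2 (M i) (M j)) : tens M :=
  tlift (fun w : forall k, fam2 (M i) (M j) k =>
    tpure (dfwith (dfwith v (w ord0 : M i)) (w ord_max : M j))) t.

Definition act2 (M : 'I_n -> glmod F N) (i j : 'I_n)
    (A : tens2 (M i) (M j) -> tens2 (M i) (M j)) (t : tens M) : tens M :=
  tlift (fun v : forall k, M k => ins2 v (A (tpure2 (v i) (v j)))) t.

Definition tpermute (M : 'I_n -> glmod F N) (s : {perm 'I_n}) (t : tens M) :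
    tens (fun k => M (s k)) :=
  tlift (fun v : forall k, M k => tpure (fun k => v (s k))) t.

Definition R_at (L : 'I_n -> hwmod F N) (i j : 'I_n) (u : F) :
    tens L -> tens L :=
  @act2 L i j (Rmatrix (L1 := L i) (L2 := L j) u).

(* The factors are applied in the order m+1, ..., n, 1, ..., m-1. *)
Definition qKZ (L : 'I_n -> hwmod F N) (p : F) (m : 'I_n) (z : 'I_n -> F)
    (t : tens L) : tens L :=
  let t' := foldl (fun x j => R_at m j (z m - z j) x) t
              [seq j : 'I_n <- enum 'I_n | (m < j)%N] in
  foldl (fun x j => R_at m j (z m - z j + p) x) t'
    [seq j : 'I_n <- enum 'I_n | (j < m)%N].

End ManyFactors.
Arguments R_at {F N n} L i j u t.
Arguments qKZ {F N n} L p m z t.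

Lemma pair2_0 (F : fieldType) (N : nat) (M1 M2 : glmod F N) (x x' : M1) (y : M2) :
  pair2 (W := @gl_car F N) x' y = dfwith (pair2 (W := @gl_car F N) x y)
    (x' : fam2 M1 M2 ord0).
Proof.
apply: functional_extensionality_dep => i.
have [<-|i0] := eqVneq ord0 i; first by rewrite dfwith_in.
by rewrite dfwith_out //; case: i i0 => [[|[]]].
Qed.

Lemma pair2_1 (F : fieldType) (N : nat) (M1 M2 : glmod F N) (x : M1) (y y' : M2) :
  pair2 (W := @gl_car F N) x y' = dfwith (pair2 (W := @gl_car F N) x y)
    (y' : fam2 M1 M2 ord_max).
Proof.
apply: functional_extensionality_dep => i.
have [<-|i1] := eqVneq ord_max i; first by rewrite dfwith_in.
by rewrite dfwith_out //; case: i i1 => [[|[]]].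
Qed.

Lemma multilinear2 (F : fieldType) (N : nat) (M1 M2 : glmod F N)
    (W : lmodType F) (f : M1 -> M2 -> W) :
  (forall x, linear (f x)) -> (forall y, linear (f^~ y)) ->
  multilinear (fun w : forall i, fam2 M1 M2 i => f (w ord0) (w ord_max)).
Proof.
move=> fr fl v i; have [i0|i0] := eqVneq i ord0.
  rewrite i0 => a x y; rewrite !dfwith_in.
  by rewrite !(@dfwith_out _ (fun i => fam2 M1 M2 i) _ ord0) ?fl.
have {i0} -> : i = ord_max by apply: val_inj; case: i i0 => [[|[]]].
move=> a x y; rewrite !dfwith_in.
by rewrite !(@dfwith_out _ (fun i => fam2 M1 M2 i) _ ord_max) ?fr.
Qed.

Lemma tpure2_linl (F : fieldType) (N : nat) (M1 M2 : glmod F N) (y : M2) :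
  linear (fun x : M1 => tpure2 x y).
Proof.
move=> a u v; rewrite /tpure2 (pair2_0 0 (a *: u + v)) (pair2_0 0 u) (pair2_0 0 v).
exact: (tpure_multilinear (pair2 (W := @gl_car F N) 0 y) (i := ord0)).
Qed.

Lemma tpure2_linr (F : fieldType) (N : nat) (M1 M2 : glmod F N) (x : M1) :
  linear (fun y : M2 => tpure2 x y).
Proof.
move=> a u v; rewrite /tpure2 (pair2_1 x 0 (a *: u + v)) (pair2_1 x 0 u) (pair2_1 x 0 v).
exact: (tpure_multilinear (pair2 (W := @gl_car F N) x 0) (i := ord_max)).
Qed.

Lemma flip_multilinear (F : fieldType) (N : nat) (M1 M2 : glmod F N) :
  multilinear (fun w : forall i, fam2 M1 M2 i =>
    tpure2 (w ord_max : M2) (w ord0 : M1)).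
Proof.
apply: (multilinear2 (f := fun (x : M1) (y : M2) => tpure2 y x)) => [x|y].
  exact: tpure2_linl.
exact: tpure2_linr.
Qed.

Lemma flip_linear (F : fieldType) (N : nat) (M1 M2 : glmod F N) :
  linear (@flip F N M1 M2).
Proof. exact/tlift_linear/flip_multilinear. Qed.

Lemma flip_pure (F : fieldType) (N : nat) (M1 M2 : glmod F N) (x : M1) (y : M2) :
  flip (tpure2 x y) = tpure2 y x.
Proof. by rewrite /flip tlift_pure //; apply: flip_multilinear. Qed.

Section ManyFactorsTheory.
Variables (F : fieldType) (N n : nat) (M : 'I_n -> glmod F N).
Implicit Type v : forall k, M k.

Lemma ins2_multilinear (i j : 'I_n) v : i != j ->
  multilinear (fun w : forall k, fam2 (M i) (M j) k =>
    tpure (dfwith (dfwith v (w ord0 : M i)) (w ord_max : M j))).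
Proof.
move=> ij; apply: (multilinear2 (f := fun (x : M i) (y : M j) =>
  tpure (dfwith (dfwith v x) y))) => [x|y].
  exact: tpure_multilinear.
move=> a u w; rewrite !(dfwith_swap (V := M) _ _ _ ij).
exact: tpure_multilinear.
Qed.

Lemma act2_multilinear (i j : 'I_n) (A : tens2 (M i) (M j) -> tens2 (M i) (M j)) :
  i != j -> linear A ->
  multilinear (fun v => ins2 v (A (tpure2 (v i) (v j)))).
Proof.
move=> ij lA v k.
have lI w : linear (@ins2 F N n M i j w).
  exact/tlift_linear/ins2_multilinear.
have [ki|ki] := eqVneq k i.
  move: ij A lA lI; case: _ / ki => ij A lA lI a x y.
  have insE u t : ins2 (i := k) (j := j) (dfwith v (u : M k)) t = ins2 v t.
    by rewrite /ins2; congr (tlift _ t); apply: funext => w; rewrite dfwith_same.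
  by rewrite !insE !dfwith_in !dfwith_out // tpure2_linl lA lI.
have [kj|kj] := eqVneq k j.
  move: ij A lA lI; case: _ / kj => ij A lA lI a x y.
  have insE u t : ins2 (i := i) (j := k) (dfwith v (u : M k)) t = ins2 v t.
    rewrite /ins2; congr (tlift _ t); apply: funext => w.
    by rewrite !(dfwith_swap (V := M) _ _ _ ij) dfwith_same.
  by rewrite !insE !dfwith_in !dfwith_out // tpure2_linr lA lI.
move=> a x y; rewrite !dfwith_out //; set t := A _.
rewrite /ins2 /tlift /feval scaler_sumr -big_split; apply: eq_bigr => c _ /=.
rewrite !(dfwith_swap (V := M) v _ _ ki).
rewrite !(dfwith_swap (V := M) _ _ _ kj) tpure_multilinear.
by rewrite scalerDr !scalerA mulrC.
Qed.

Lemma act2_linear (i j : 'I_n) (A : tens2 (M i) (M j) -> tens2 (M i) (M j)) :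
  i != j -> linear A -> linear (act2 A).
Proof. by move=> ij lA; apply/tlift_linear/act2_multilinear. Qed.

Lemma ins2_pure (i j : 'I_n) v (x : M i) (y : M j) : i != j ->
  ins2 v (tpure2 x y) = tpure (dfwith (dfwith v x) y).
Proof. by move=> ij; rewrite /ins2 tlift_pure //; apply: ins2_multilinear. Qed.

Lemma act2_pure (i j : 'I_n) (A : tens2 (M i) (M j) -> tens2 (M i) (M j)) v :
  i != j -> linear A ->
  act2 A (tpure v) = ins2 v (A (tpure2 (v i) (v j))).
Proof.
by move=> ij lA; rewrite /act2 tlift_pure //; apply: act2_multilinear.
Qed.

Lemma tpermute_multilinear (s : {perm 'I_n}) :
  multilinear (fun v => tpure (V := fun k => M (s k)) (fun k => v (s k))).
Proof.
move=> v i; rewrite -(permKV s i) => a x y.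
have E u : (fun k => dfwith v (u : M (s (s^-1%g i))) (s k)) =
           dfwith (T := fun k => M (s k)) (fun k => v (s k)) (i := s^-1%g i) u.
  apply: functional_extensionality_dep => k.
  have [<-|ik] := eqVneq (s^-1%g i) k; first by rewrite !dfwith_in.
  by rewrite !dfwith_out // (inj_eq perm_inj).
rewrite !E.
exact: (tpure_multilinear (V := fun k => M (s k)) (fun k => v (s k))).
Qed.

Lemma tpermute_linear (s : {perm 'I_n}) : linear (@tpermute F N n M s).
Proof. exact/tlift_linear/tpermute_multilinear. Qed.

Lemma tpermute_pure (s : {perm 'I_n}) v :
  tpermute s (tpure v) = tpure (V := fun k => M (s k)) (fun k => v (s k)).
Proof.
by rewrite /tpermute tlift_pure //; apply: tpermute_multilinear.
Qed.

End ManyFactorsTheory.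

Section ConformalBlocks.
Variables (F : fieldType) (r n : nat).
Local Notation N := r.+1.

Definition h_theta (M : glmod F N) (v : M) : M := gl_h ord0 v - gl_h ord_max v.

Definition singular (M : glmod F N) : set M :=
  [set v | forall i j : 'I_N, j = i.+1 :> nat -> gl_e i j v = 0]%classic.

(* T_{N1}^(2) - T_{NN}^(1) T_{N1}^(1), with indices starting from 0. *)
Definition y_e (Y : ymod F N) (v : Y) : Y :=
  y_T ord_max ord0 2 v - y_T ord_max ord_max 1 (y_T ord_max ord0 1 v).

Variable L : 'I_n -> hwmod F N.

Definition e_op (z : 'I_n -> F) (t : tens L) : tens L :=
  @y_e (yev_tens L z) t.

Definition tens_wt (i : 'I_N) : F := \sum_k hw_wt (L k) i.

Definition sing_l (l : nat) : set (gl_tens L) :=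
  [set t | singular t /\
     h_theta t = (tens_wt ord0 - tens_wt ord_max - l%:R) *: t]%classic.

Definition resonance (p : F) (l k : nat) : Prop :=
  forall t : gl_tens L, sing_l l t ->
    2 *: h_theta t + (p + N%:R + k%:R - 1) *: t = 0.

(* When [sing_l l] is nonzero at most one [k] is resonant; when it is zero all
   conditions are void. *)
Definition conformal_blocks (p : F) (l : nat) (z : 'I_n -> F) : set (tens L) :=
  [set t | sing_l l t /\
     forall k, (1 <= k <= l)%N -> resonance p l k ->
       iter k (e_op z) t = 0]%classic.

End ConformalBlocks.
Arguments conformal_blocks {F r n} L p l z.

(* Main.v *)
Require Import Defs.
From mathcomp Require Import all_boot all_order all_algebra perm.
From mathcomp Require Import ring.
From mathcomp Require Import boolp classical_sets reals complex.
Import GRing.Theory Num.Theory.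
Local Open Scope ring_scope.
Local Open Scope complex_scope.
Local Open Scope classical_set_scope.

Set Implicit Arguments.
Unset Strict Implicit.
Unset Printing Implicit Defensive.

(* P R_{L_i L_{i+1}} is a bijective intertwiner of Yangian modules, so it maps
   conformal blocks onto conformal blocks for the exchanged order of factors.
   The operator K_m(z) is a product of such exchanges, moving the factor L_m to
   the last place and then from the first place back to its own, so that what
   remains is the cyclic move from the last place to the first one, with z_m
   replaced by z_m + p.

   On singular vectors e(z) acts as T = T_{N1}^(2); put X = e_{1N} acting on the
   moved factor.  A direct computation on singular vectors gives
   T' = T + X (2 h_theta + p + N) for the operator T' of the new order, and
   [X, T] = X^2.  If 2 h_theta = -(p + N + k - 1) on t, then
   T'^k t = (T + (k-1) X) (T + (k-3) X) ... (T - (k-1) X) t = T^k t.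

   The R-matrix exists because the vectors of top degree in a tensor product of
   two highest weight modules are the multiples of v_1 (x) v_2. *)

(** * The Yangian action for an arbitrary order of the factors *)

(** Both sides run over the triples with [r + q + u = s], grouped by [r] on the left and by
    [p = r + q] on the right. This regrouping is the content of coassociativity. *)
Lemma sum_triangle (V : zmodType) (f : nat -> nat -> nat -> V) s :
  \sum_(r < s.+1) \sum_(q < (s - r).+1) f r q (s - r - q)%N =
  \sum_(p < s.+1) \sum_(r < p.+1) f r (p - r)%N (s - p)%N.
Proof.
elim: s f => [|s IH] f; first by rewrite !big_ord1.
rewrite big_ord_recl /= subn0.
under [RHS]eq_bigr => p _ do rewrite big_ord_recl /= subn0.
rewrite [RHS]big_split /=; congr (_ + _).
rewrite [RHS]big_ord_recl /= big_ord0 add0r.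
by rewrite -(IH (fun r => f r.+1)).
Qed.

Section CoprodT.
Variables (F : fieldType) (N : nat).
Implicit Types V W : lmodType F.

Lemma coprod_linear V (A B : 'I_N -> 'I_N -> nat -> V -> V) i j s :
  (forall i j s, linear (A i j s)) -> (forall i j s, linear (B i j s)) ->
  linear (coprod_T A B i j s).
Proof.
by move=> lA lB; apply: lin_sum => k; apply: lin_sum => r; apply: lin_comp.
Qed.

Lemma coprod_morph V W (A B : 'I_N -> 'I_N -> nat -> V -> V)
    (A' B' : 'I_N -> 'I_N -> nat -> W -> W) (phi : V -> W) :
  linear phi ->
  (forall i j s v, phi (A i j s v) = A' i j s (phi v)) ->
  (forall i j s v, phi (B i j s v) = B' i j s (phi v)) ->
  forall i j s v, phi (coprod_T A B i j s v) = coprod_T A' B' i j s (phi v).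
Proof.
move=> lphi hA hB i j s v; rewrite /coprod_T (linS lphi).
apply: eq_bigr => k _; rewrite (linS lphi); apply: eq_bigr => r _.
by rewrite hA hB.
Qed.

(** Coassociativity: it allows a product over a list of factors to be cut at any place. *)
Lemma coprodA V (A B C : 'I_N -> 'I_N -> nat -> V -> V) i j s v :
  (forall i j s, linear (A i j s)) ->
  coprod_T A (coprod_T B C) i j s v = coprod_T (coprod_T A B) C i j s v.
Proof.
move=> lA; rewrite /coprod_T.
under eq_bigr => k _.
  under eq_bigr => r _.
    rewrite (linS (lA _ _ _)).
    under eq_bigr => l _ do rewrite (linS (lA _ _ _)).
    over.
  rewrite exchange_big /=.
  under eq_bigr => l _ do
    rewrite (sum_triangle (fun r q u => A i k r (B k l q (C l j u v)))).
  over.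
rewrite exchange_big /=; apply: eq_bigr => l _.
by rewrite exchange_big.
Qed.

(** The counit of the Yangian, through which it acts on the empty product of factors. *)
Definition counit V (i j : 'I_N) (s : nat) (v : V) : V :=
  if s is 0 then (i == j)%:R *: v else 0.

Lemma coprod_counit V (A : 'I_N -> 'I_N -> nat -> V -> V) i j s v :
  (forall i j s, linear (A i j s)) ->
  coprod_T A (@counit V) i j s v = A i j s v.
Proof.
move=> lA; rewrite /coprod_T (bigD1 j) //= [X in _ + X]big1 ?addr0 => [|k /negPf kj].
  rewrite big_ord_recr big1 ?add0r => [|r _]; last first.
    by rewrite /counit /= -(@subnSK r) //= (lin0 (lA _ _ _)).
  by rewrite /= subnn /counit eqxx scale1r add0r.
rewrite big1 // => r _; rewrite /counit; case: subn => [|u].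
  by rewrite kj scale0r (lin0 (lA _ _ _)).
by rewrite (lin0 (lA _ _ _)).
Qed.

Lemma coprod_counitl V (A : 'I_N -> 'I_N -> nat -> V -> V) i j s v :
  coprod_T (@counit V) A i j s v = A i j s v.
Proof.
rewrite /coprod_T; under eq_bigr => k _ do
  rewrite big_ord_recl subn0 /= big1 ?addr0 //.
rewrite (bigD1 i) //= eqxx scale1r big1 ?addr0 // => k.
by rewrite eq_sym => /negPf ->; rewrite scale0r.
Qed.

Lemma coprod1 V (A B : 'I_N -> 'I_N -> nat -> V -> V) i j v :
  (forall i j v, A i j 0%N v = (i == j)%:R *: v) ->
  (forall i j v, B i j 0%N v = (i == j)%:R *: v) ->
  (forall i j s, linear (A i j s)) ->
  coprod_T A B i j 1 v = A i j 1%N v + B i j 1%N v.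
Proof.
move=> A0 B0 lA; rewrite /coprod_T.
under eq_bigr => k _ do rewrite big_ord_recl big_ord1 /= A0 B0 (linZ (lA _ _ _)).
rewrite big_split /= addrC; congr (_ + _).
- rewrite (bigD1 j) //= eqxx scale1r big1 ?addr0 // => k /negPf ->.
  by rewrite scale0r.
- rewrite (bigD1 i) //= eqxx scale1r big1 ?addr0 // => k.
  by rewrite eq_sym => /negPf ->; rewrite scale0r.
Qed.

Lemma coprod2 V (A B : 'I_N -> 'I_N -> nat -> V -> V) i j v :
  (forall i j v, A i j 0%N v = (i == j)%:R *: v) ->
  (forall i j v, B i j 0%N v = (i == j)%:R *: v) ->
  (forall i j s, linear (A i j s)) ->
  coprod_T A B i j 2 v =
  A i j 2%N v + B i j 2%N v + \sum_k A i k 1%N (B k j 1%N v).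
Proof.
move=> A0 B0 lA; rewrite /coprod_T.
under eq_bigr => k _ do
  rewrite big_ord_recl big_ord_recl big_ord1 /= A0 B0 (linZ (lA _ _ _)).
rewrite !big_split /= addrA addrC addrA; congr (_ + _ + _).
- rewrite (bigD1 j) //= eqxx scale1r big1 ?addr0 // => k /negPf ->.
  by rewrite scale0r.
- rewrite (bigD1 i) //= eqxx scale1r big1 ?addr0 // => k.
  by rewrite eq_sym => /negPf ->; rewrite scale0r.
Qed.

End CoprodT.

Section WordT.
Variables (F : fieldType) (N n : nat) (M : 'I_n -> glmod F N) (z : 'I_n -> F).

(* [mono_T] over evaluation modules, seen as acting on [tens M]: all orders of
   the factors act on this one space, so that no permutation is needed when the
   order changes. *)
Fixpoint word_T (s : seq 'I_n) : 'I_N -> 'I_N -> nat -> tens M -> tens M :=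
  if s is m :: s' then
    coprod_T (fun i j r => at_ M m (@ev_T _ _ (M m) (z m) i j r)) (word_T s')
  else @counit F N (tens M).
End WordT.

Section Words.
Variables (F : fieldType) (N n : nat) (M : 'I_n -> glmod F N).
Implicit Types (z : 'I_n -> F) (s : seq 'I_n).
Local Notation word_T := (word_T (M := M)).

(** The carrier of [yev] is the module itself, so [mono_T] and [word_T] are convertible. *)
Lemma y_T_word z : @y_T _ _ (yev_tens M z) = word_T z (enum 'I_n).
Proof. reflexivity. Qed.

Lemma word_action z s : uniq s -> yangian_action (word_T z s).
Proof. exact: (@mono_action F N n (fun i => yev (M i) (z i))). Qed.

Lemma ev_linear (X : glmod F N) x i j r : linear (@ev_T _ _ X x i j r).
Proof. by case: (ev_action X x). Qed.

Lemma at_ev_linear m x i j r : linear (at_ M m (@ev_T _ _ (M m) x i j r)).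
Proof. exact/at_linear/ev_linear. Qed.

Lemma at_gl_linear m i j : linear (at_ M m (@gl_e _ _ (M m) i j)).
Proof. exact/at_linear/gl_linear. Qed.

Lemma word_linear z s i j r : linear (word_T z s i j r).
Proof.
elim: s i j r => [|m s IH] i j r /=.
  by case: r => [|r] a x y; rewrite /counit /= ?lin_scale // scaler0 addr0.
by apply: coprod_linear => // *; apply: at_ev_linear.
Qed.

Lemma at_ev0 m x i j t : at_ M m (@ev_T _ _ (M m) x i j 0) t = (i == j)%:R *: t.
Proof. by rewrite -(at_scale m). Qed.

Lemma at_ev1 m x i j t :
  at_ M m (@ev_T _ _ (M m) x i j 1) t = at_ M m (@gl_e _ _ (M m) j i) t.
Proof.
congr (at_ M m _ t); apply: functional_extensionality_dep => v.
by rewrite /= expr0 scale1r.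
Qed.

Lemma at_Z m a (g : M m -> M m) t : linear g ->
  at_ M m (fun x => a *: g x) t = a *: at_ M m g t.
Proof.
move=> lg; rewrite -[RHS](at_scale m) at_comp //; exact: lin_scale.
Qed.

Lemma at_evS m x i j r t :
  at_ M m (@ev_T _ _ (M m) x i j r.+1) t = x ^+ r *: at_ M m (@gl_e _ _ (M m) j i) t.
Proof. by rewrite -at_Z //; apply: gl_linear. Qed.

Lemma word0 z s i j t : word_T z s i j 0 t = (i == j)%:R *: t.
Proof.
elim: s i j t => [|m s IH] i j t //=.
rewrite /coprod_T; under eq_bigr => k _ do
  rewrite big_ord1 /= subn0 IH (linZ (at_ev_linear _ _ _ _ _)) at_ev0.
rewrite (bigD1 j) //= eqxx scale1r big1 ?addr0 // => k /negPf ->.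
by rewrite scale0r.
Qed.

Lemma word1 z s i j t :
  word_T z s i j 1 t = \sum_(m <- s) at_ M m (@gl_e _ _ (M m) j i) t.
Proof.
elim: s => [|m s IH]; first by rewrite big_nil.
rewrite big_cons /= coprod1 ?at_ev1 ?IH // => *.
- exact: at_ev0.
- exact: word0.
- exact: at_ev_linear.
Qed.

(** [T_ij^(1)] is primitive and evaluates to [e_ji], so it does not see the order of the factors. *)
Lemma word1_gl z s i j t : perm_eq s (enum 'I_n) ->
  word_T z s i j 1 t = gl_tens_e j i t.
Proof. by move=> ps; rewrite word1 (perm_big _ ps) /= big_enum. Qed.

Lemma eq_word z z' s : {in s, z =1 z'} -> word_T z s = word_T z' s.
Proof.
elim: s => //= m s IH zz; rewrite zz ?mem_head // IH // => k ks.
by apply: zz; rewrite inE ks orbT.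
Qed.

Lemma word_cat z s1 s2 i j r t :
  word_T z (s1 ++ s2) i j r t = coprod_T (word_T z s1) (word_T z s2) i j r t.
Proof.
elim: s1 i j r t => [|m s1 IH] i j r t /=; first by rewrite coprod_counitl.
rewrite -coprodA; last by move=> *; apply: at_ev_linear.
by apply: eq_bigr => k _; apply: eq_bigr => q _; rewrite IH.
Qed.

End Words.

Lemma word_pair (F : fieldType) (N n : nat) (M : 'I_n -> glmod F N) z k l a b r t :
  word_T (M := M) z [:: k; l] a b r t =
  coprod_T (fun i j r => at_ M k (@ev_T _ _ (M k) (z k) i j r))
    (fun i j r => at_ M l (@ev_T _ _ (M l) (z l) i j r)) a b r t.
Proof.
apply: eq_bigr => c _; apply: eq_bigr => q _; congr (at_ _ _ _ _).
by rewrite /= coprod_counit // => *; apply: at_ev_linear.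
Qed.

(** * Tensor products of two modules *)

Section TwoFactors.
Variables (F : fieldType) (N : nat).
Implicit Types M : glmod F N.

Lemma pair2_eta M1 M2 (w : forall k, fam2 M1 M2 k) :
  pair2 (W := @gl_car F N) (w ord0 : M1) (w ord_max : M2) = w.
Proof.
apply: functional_extensionality_dep => k.
have [->|k0] := eqVneq k ord0; first by [].
have -> // : k = ord_max by apply: val_inj; case: k k0 => [[|[]]].
Qed.

Lemma tens2_ext M1 M2 (W : lmodType F) (f g : tens2 M1 M2 -> W) :
  linear f -> linear g -> (forall x y, f (tpure2 x y) = g (tpure2 x y)) ->
  f =1 g.
Proof.
move=> lf lg fg; apply: (tens_ext lf lg) => w.
by rewrite -(pair2_eta w) -!/(tpure2 _ _) fg.
Qed.

(** Typing [g] on [M1] instead of [fam2 M1 M2 ord0] keeps the family out of later statements. *)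
Definition at2l M1 M2 (g : M1 -> M1) : tens2 M1 M2 -> tens2 M1 M2 :=
  at_ (fam2 M1 M2) ord0 g.
Definition at2r M1 M2 (g : M2 -> M2) : tens2 M1 M2 -> tens2 M1 M2 :=
  at_ (fam2 M1 M2) ord_max g.

Lemma at2l_linear M1 M2 (g : M1 -> M1) : linear g -> linear (@at2l M1 M2 g).
Proof. by move=> lg; apply: at_linear. Qed.
Lemma at2r_linear M1 M2 (g : M2 -> M2) : linear g -> linear (@at2r M1 M2 g).
Proof. by move=> lg; apply: at_linear. Qed.

Lemma at2l_pure M1 M2 (g : M1 -> M1) (x : M1) (y : M2) : linear g ->
  at2l g (tpure2 x y) = tpure2 (g x) y.
Proof. by move=> lg; rewrite /at2l at_pure // /tpure2 (pair2_0 x (g x)). Qed.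
Lemma at2r_pure M1 M2 (g : M2 -> M2) (x : M1) (y : M2) : linear g ->
  at2r g (tpure2 x y) = tpure2 x (g y).
Proof. by move=> lg; rewrite /at2r at_pure // /tpure2 (pair2_1 x y (g y)). Qed.

Lemma flipK M1 M2 : cancel (@flip F N M1 M2) (@flip F N M2 M1).
Proof.
apply: tens2_ext => //; first by apply: lin_comp; apply: flip_linear.
by move=> x y; rewrite !flip_pure.
Qed.

Lemma flip_at2l M1 M2 (g : M1 -> M1) (t : tens2 M1 M2) : linear g ->
  flip (at2l g t) = at2r g (flip t).
Proof.
move=> lg; move: t; apply: tens2_ext => [||x y].
- exact: lin_comp (@flip_linear _ _ _ _) (at2l_linear lg).
- exact: lin_comp (at2r_linear lg) (@flip_linear _ _ _ _).
by rewrite at2l_pure // !flip_pure at2r_pure.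
Qed.

Lemma flip_at2r M1 M2 (g : M2 -> M2) (t : tens2 M1 M2) : linear g ->
  flip (at2r g t) = at2l g (flip t).
Proof. by move=> lg; rewrite -{1}(flipK t) -flip_at2l // flipK. Qed.

Definition T2 M1 M2 (x y : F) : 'I_N -> 'I_N -> nat -> tens2 M1 M2 -> tens2 M1 M2 :=
  coprod_T (fun i j r => at2l (@ev_T _ _ M1 x i j r))
           (fun i j r => at2r (@ev_T _ _ M2 y i j r)).

Lemma enum2 : enum 'I_2 = [:: ord0; ord_max].
Proof. by apply: (inj_map val_inj); rewrite val_enum_ord. Qed.

Lemma yev2_T M1 M2 x y i j r t : @y_T _ _ (yev2 M1 M2 x y) i j r t = T2 x y i j r t.
Proof.
by rewrite /yev2 y_T_word enum2 word_pair.
Qed.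
End TwoFactors.

(** * Operators acting on two of the factors *)

Section Act2.
Variables (F : fieldType) (N n : nat) (M : 'I_n -> glmod F N) (i j : 'I_n).
Hypothesis ij : i != j.
Implicit Types (v : forall k, M k) (t : tens2 (M i) (M j)).

Lemma ins2_linear v : linear (@ins2 F N n M i j v).
Proof. exact: tlift_linear (ins2_multilinear v ij). Qed.

Lemma ins2_id v : ins2 v (tpure2 (v i) (v j)) = tpure v.
Proof. by rewrite ins2_pure // dfwith_id dfwith_id. Qed.

Lemma at_ins2l v (g : M i -> M i) t : linear g ->
  at_ M i g (ins2 v t) = ins2 v (at2l g t).
Proof.
move=> lg; move: t; apply: tens2_ext => [||x y].
- exact: lin_comp (at_linear lg) (ins2_linear v).
- exact: lin_comp (ins2_linear v) (at2l_linear lg).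
rewrite at2l_pure // !ins2_pure // at_pure // dfwith_out 1?eq_sym // dfwith_in.
by rewrite (dfwith_swap (V := M) (dfwith v x)) 1?eq_sym // dfwith_same.
Qed.

Lemma at_ins2r v (g : M j -> M j) t : linear g ->
  at_ M j g (ins2 v t) = ins2 v (at2r g t).
Proof.
move=> lg; move: t; apply: tens2_ext => [||x y].
- exact: lin_comp (at_linear lg) (ins2_linear v).
- exact: lin_comp (ins2_linear v) (at2r_linear lg).
by rewrite at2r_pure // !ins2_pure // at_pure // dfwith_same dfwith_in.
Qed.

Lemma at_ins2_out m v (g : M m -> M m) t : linear g -> m != i -> m != j ->
  at_ M m g (ins2 v t) = ins2 (dfwith v (g (v m))) t.
Proof.
move=> lg mi mj; move: t; apply: tens2_ext => [||x y].
- exact: lin_comp (at_linear lg) (ins2_linear v).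
- exact: ins2_linear.
rewrite !ins2_pure // at_pure // !dfwith_out 1?eq_sym //.
by rewrite (dfwith_swap (V := M) (dfwith v x)) 1?eq_sym //
  (dfwith_swap (V := M) v) // eq_sym.
Qed.

Variable A : tens2 (M i) (M j) -> tens2 (M i) (M j).
Hypothesis lA : linear A.

(** [ins2] overwrites the entries of [v] at [i] and [j], so [act2 A] sees only [t] there. *)
Lemma act2_ins2 v t : act2 A (ins2 v t) = ins2 v (A t).
Proof.
move: t; apply: tens2_ext => [||x y].
- exact: lin_comp (act2_linear ij lA) (ins2_linear v).
- exact: lin_comp (ins2_linear v) lA.
rewrite ins2_pure // act2_pure // dfwith_in dfwith_out 1?eq_sym // dfwith_in.
move: (A _); apply: tens2_ext; try exact: ins2_linear.
move=> a b; rewrite !ins2_pure //; congr tpure.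
by rewrite -(dfwith_swap (V := M) (dfwith v x)) // !dfwith_same.
Qed.

Lemma act2_at m (g : M m -> M m) u : linear g -> m != i -> m != j ->
  act2 A (at_ M m g u) = at_ M m g (act2 A u).
Proof.
move=> lg mi mj; move: u; apply: tens_ext => [||v].
- exact: lin_comp (act2_linear ij lA) (at_linear lg).
- exact: lin_comp (at_linear lg) (act2_linear ij lA).
rewrite -{1}ins2_id at_ins2_out // act2_ins2 act2_pure // at_ins2_out //.
Qed.

Variables (z : 'I_n -> F).
Hypothesis intA : forall a b r t,
  flip (A (T2 (z i) (z j) a b r t)) = T2 (z j) (z i) a b r (flip (A t)).

(** Both orders act on the one space [tens M], so no flip appears: the word [[:: j; i]] is the
    action [T2] on the exchanged product, conjugated by [flip]. *)
Lemma act2_word2 a b r u :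
  act2 A (word_T z [:: i; j] a b r u) = word_T z [:: j; i] a b r (act2 A u).
Proof.
have lw s := @word_linear F N n M z s.
have ins_ij v t a' b' r' : ins2 v (T2 (z i) (z j) a' b' r' t) =
    word_T z [:: i; j] a' b' r' (ins2 v t).
  rewrite word_pair; apply: coprod_morph => [|*|*]; first exact: ins2_linear.
  - by rewrite at_ins2l //; apply: ev_linear.
  - by rewrite at_ins2r //; apply: ev_linear.
have ins_ji v (w : tens2 (M j) (M i)) a' b' r' :
    ins2 v (flip (T2 (z j) (z i) a' b' r' w)) =
    word_T z [:: j; i] a' b' r' (ins2 v (flip w)).
  rewrite word_pair;
  apply: (coprod_morph (phi := fun w => ins2 v (flip w))) => [|*|*].
  - exact: lin_comp (ins2_linear v) (@flip_linear _ _ _ _).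
  - by rewrite flip_at2l ?at_ins2r //; apply: ev_linear.
  - by rewrite flip_at2r ?at_ins2l //; apply: ev_linear.
move: u; apply: tens_ext => [||v].
- exact: lin_comp (act2_linear ij lA) (lw _ _ _ _).
- exact: lin_comp (lw _ _ _ _) (act2_linear ij lA).
rewrite -(ins2_id v) -ins_ij !act2_ins2 -[X in ins2 v X]flipK intA.
by rewrite ins_ji flipK.
Qed.

(** By [word_cat] the word is a coproduct of three pieces. The outer two avoid [i] and [j] and
    commute with [act2 A]; the middle one is [act2_word2]. *)
Lemma act2_word s1 s2 a b r u : i \notin s1 ++ s2 -> j \notin s1 ++ s2 ->
  act2 A (word_T z (s1 ++ [:: i, j & s2]) a b r u) =
  word_T z (s1 ++ [:: j, i & s2]) a b r (act2 A u).
Proof.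
have lact := act2_linear ij lA.
have out s : i \notin s -> j \notin s -> forall a b r u,
    act2 A (word_T z s a b r u) = word_T z s a b r (act2 A u).
  elim: s => [_ _ a' b' [|r'] u'|m s IH] /=.
  - by rewrite (linZ lact).
  - by rewrite (lin0 lact).
  rewrite !inE !negb_or => /andP[im si] /andP[jm sj].
  apply: coprod_morph => // [*|]; last exact: IH.
  by rewrite act2_at 1?eq_sym //; apply: ev_linear.
rewrite !mem_cat !negb_or => /andP[i1 i2] /andP[j1 j2].
rewrite !word_cat; move: a b r u; apply: coprod_morph => //; first exact: out.
move=> a b r u; rewrite -[[:: i, j & s2]]/([:: i; j] ++ s2).
rewrite -[[:: j, i & s2]]/([:: j; i] ++ s2) !word_cat.
by move: a b r u; apply: coprod_morph => //; [exact: act2_word2|exact: out].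
Qed.
End Act2.

(** * Rational R-matrices *)

Section TwoFactorYangian.
Variables (F : fieldType) (N : nat).
Implicit Types M : glmod F N.

(** The complete homogeneous symmetric polynomial of degree [s - 1] in [x] and [y], with value 0 at
    [s = 0]. *)
Definition hsum (x y : F) s : F := \sum_(r < s) x ^+ r * y ^+ (s - r.+1).

Lemma hsumS x y s : hsum x y s.+1 = y ^+ s + x * hsum x y s.
Proof.
rewrite /hsum big_ord_recl expr0 mul1r subSS subn0; congr (_ + _).
by rewrite mulr_sumr; apply: eq_bigr => r _; rewrite exprS mulrA.
Qed.

(** The mixed term of the comultiplication of [T_ij^(2)]; it is free of the evaluation points. *)
Definition ee M1 M2 (i j : 'I_N) (t : tens2 M1 M2) : tens2 M1 M2 :=
  \sum_k at2l (@gl_e _ _ M1 k i) (at2r (@gl_e _ _ M2 j k) t).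

Lemma at2l_ev0 M1 M2 x i j (t : tens2 M1 M2) :
  at2l (@ev_T _ _ M1 x i j 0) t = (i == j)%:R *: t.
Proof. exact: at_ev0. Qed.
Lemma at2r_ev0 M1 M2 x i j (t : tens2 M1 M2) :
  at2r (@ev_T _ _ M2 x i j 0) t = (i == j)%:R *: t.
Proof. exact: at_ev0. Qed.
Lemma at2l_evS M1 M2 x i j r (t : tens2 M1 M2) :
  at2l (@ev_T _ _ M1 x i j r.+1) t = x ^+ r *: at2l (@gl_e _ _ M1 j i) t.
Proof. exact: at_evS. Qed.
Lemma at2r_evS M1 M2 x i j r (t : tens2 M1 M2) :
  at2r (@ev_T _ _ M2 x i j r.+1) t = x ^+ r *: at2r (@gl_e _ _ M2 j i) t.
Proof. exact: at_evS. Qed.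

(** The extreme terms of the comultiplication give the two one-factor terms. In all others the
    powers of [x] and [y] split off, and the remaining sum over [k] is always [ee]. *)
Lemma T2S M1 M2 x y i j s (t : tens2 M1 M2) :
  T2 x y i j s.+1 t = x ^+ s *: at2l (@gl_e _ _ M1 j i) t
    + y ^+ s *: at2r (@gl_e _ _ M2 j i) t + hsum x y s *: ee i j t.
Proof.
have ll M M' a b : linear (@at2l F N M M' (@gl_e _ _ M a b)).
  exact/at2l_linear/gl_linear.
rewrite /T2 /coprod_T; under eq_bigr => k _.
  rewrite big_ord_recl big_ord_recr /= /bump /= !add1n subSS subnn subn0.
  rewrite at2l_ev0 at2r_ev0 at2l_evS at2r_evS (linZ (ll _ _ _ _)).
  under eq_bigr => r _.
    rewrite /bump /= add1n at2l_evS subSS -(subnSK (ltn_ord r)) at2r_evS.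
    rewrite (linZ (ll _ _ _ _)) scalerA.
    over.
  rewrite -scaler_suml -/(hsum x y s).
  over.
rewrite big_split /= big_split /= -scaler_sumr -/(ee i j t) addrA addrC addrA.
congr (_ + _ + _).
- rewrite (bigD1 j) //= eqxx scale1r big1 ?addr0 // => k /negPf kj.
  by rewrite kj scale0r scaler0.
- rewrite (bigD1 i) //= eqxx scale1r big1 ?addr0 // => k.
  by rewrite eq_sym => /negPf ->; rewrite scale0r.
Qed.

Lemma T2_0 M1 M2 x y i j (t : tens2 M1 M2) : T2 x y i j 0 t = (i == j)%:R *: t.
Proof. by rewrite -yev2_T; case: (y_action (yev2 M1 M2 x y)). Qed.

Lemma T2_1 M1 M2 x y i j (t : tens2 M1 M2) :
  T2 x y i j 1 t = at2l (@gl_e _ _ M1 j i) t + at2r (@gl_e _ _ M2 j i) t.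
Proof. by rewrite T2S !expr0 !scale1r /hsum big_ord0 scale0r addr0. Qed.

(* Hence intertwining T^(1) and T^(2) is enough, and a simultaneous
   shift of x and y only adds a multiple of T^(1) to T^(2). *)
Lemma T2_rec M1 M2 x y i j s (t : tens2 M1 M2) :
  T2 x y i j s.+3 t = (x + y) *: T2 x y i j s.+2 t - (x * y) *: T2 x y i j s.+1 t.
Proof.
rewrite !T2S !hsumS; move: (at2l _ _) (at2r _ _) (ee _ _ _) => a b c.
rewrite !scalerDr !scalerA 2!opprD addrACA [X in _ = X + _]addrACA -!scalerBl.
by congr (_ *: _ + _ *: _ + _ *: _); rewrite !exprS; ring.
Qed.

Lemma T2_shift M1 M2 x y c i j (t : tens2 M1 M2) :
  T2 (x + c) (y + c) i j 2 t = T2 x y i j 2 t + c *: T2 x y i j 1 t.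
Proof.
rewrite T2_1 !T2S !expr1 !hsumS /hsum !big_ord0 !mulr0 !addr0 !expr0.
by rewrite !scalerDl scalerDr addrACA [LHS]addrAC.
Qed.

(** This is why the R-matrix depends on [x - y] only. A shift fixes [T^(1)] and adds [c] times
    [T^(1)] to [T^(2)]; higher generators follow from [T2_rec], whose coefficients are symmetric in
    the two points. *)
Lemma intertwine2_shift M1 M2 x y c (f : tens2 M1 M2 -> tens2 M2 M1) : linear f ->
  (forall i j s t, f (T2 x y i j s t) = T2 y x i j s (f t)) ->
  forall i j s t, f (T2 (x + c) (y + c) i j s t) = T2 (y + c) (x + c) i j s (f t).
Proof.
move=> lf hf i j s t; case: s => [|s]; first by rewrite !T2_0 (linZ lf).
have h1 : f (T2 (x + c) (y + c) i j 1 t) = T2 (y + c) (x + c) i j 1 (f t).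
  by have := hf i j 1%N t; rewrite !T2_1.
have h2 : f (T2 (x + c) (y + c) i j 2 t) = T2 (y + c) (x + c) i j 2 (f t).
  by rewrite !T2_shift (linD lf) (linZ lf) !hf.
(* The recursion has order two, so the induction carries two consecutive degrees. *)
suff [] : f (T2 (x + c) (y + c) i j s.+1 t) = T2 (y + c) (x + c) i j s.+1 (f t)
  /\ f (T2 (x + c) (y + c) i j s.+2 t) = T2 (y + c) (x + c) i j s.+2 (f t) by [].
elim: s => [//|s [IH1 IH2]]; split=> //.
rewrite !T2_rec (linB lf) !(linZ lf) IH1 IH2.
by rewrite [y + c + _]addrC [(y + c) * _]mulrC.
Qed.

End TwoFactorYangian.

(** * Gradings bounded above, and vectors of top degree *)

Section Below.
Variables (F : fieldType) (char0 : forall k, k.+1%:R != 0 :> F).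

Inductive below (V : lmodType F) (D : V -> V) (top : F) : V -> Prop :=
| below_lin a x y : below D top x -> below D top y -> below D top (a *: x + y)
| below_eigen k x : D x = (top - k.+1%:R) *: x -> below D top x.

Section BelowV.
Variables (V : lmodType F) (D : V -> V) (lD : linear D) (top : F).
Local Notation below := (below D top).

Lemma below0 : below 0.
Proof. by apply: (@below_eigen _ _ _ 0); rewrite (lin0 lD) scaler0. Qed.

(** The polynomial [(D - (top - 1)) ... (D - (top - K))] in [D]. It separates the eigenvalue [top]
    from the lower ones without a direct sum decomposition. *)
Fixpoint annih K (x : V) : V :=
  if K is K'.+1 then D (annih K' x) - (top - K%:R) *: annih K' x else x.

Lemma annih_linear K : linear (annih K).
Proof.
elim: K => //= K IH a x y; rewrite IH lD scalerDr opprD addrACA.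
by rewrite scalerBr !scalerA [a * _]mulrC.
Qed.

Lemma annih_eigen K mu x : D x = mu *: x ->
  annih K x = (\prod_(k < K) (mu - (top - k.+1%:R))) *: x.
Proof.
move=> Dx; elim: K => [|K IH]; first by rewrite big_ord0 scale1r.
rewrite /= IH (linZ lD) Dx !scalerA -scalerBl big_ord_recr /=.
by congr (_ *: _); ring.
Qed.

Lemma annih_eq0 K K' x : (K <= K')%N -> annih K x = 0 -> annih K' x = 0.
Proof.
move/subnK => <- x0; elim: (K' - K)%N => //= k IH.
by rewrite IH (lin0 lD) scaler0 subrr.
Qed.

Lemma below_annih x : below x -> exists K, annih K x = 0.
Proof.
elim=> {x} [a x y _ [K xK] _ [K' yK']|k x Dx].
  exists (maxn K K'); rewrite annih_linear (annih_eq0 (leq_maxl _ _) xK).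
  by rewrite (annih_eq0 (leq_maxr _ _) yK') scaler0 addr0.
exists k.+1; rewrite (annih_eigen _ Dx) big_ord_recr /= subrr mulr0.
by rewrite scale0r.
Qed.

(** On the eigenvalue [top] the operator [annih K] is the scalar [K!], which [char0] makes nonzero,
    yet some [annih K] kills [x]. *)
Lemma below_top x : below x -> D x = top *: x -> x = 0.
Proof.
move=> /below_annih[K xK] Dx; apply/eqP; move/eqP: xK.
rewrite (annih_eigen _ Dx) scaler_eq0 => /orP[|//].
rewrite prodf_seq_eq0 => /hasP[k _] /=.
by rewrite opprB addrC subrK (negPf (char0 k)).
Qed.
End BelowV.

Variable N : nat.

(* Principal grading: e_ab shifts the eigenvalues of [deg] by b - a. *)
Definition deg (M : glmod F N) (x : M) : M := - \sum_(i < N) i%:R *: gl_e i i x.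

Lemma deg_linear (M : glmod F N) : linear (@deg M).
Proof.
have l : linear (fun x : M => \sum_(i < N) i%:R *: gl_e i i x).
  by apply: lin_sum => i; apply: lin_comp; [exact: lin_scale|exact: gl_linear].
by move=> a x y; rewrite /deg l opprD scalerN.
Qed.

(** Sum [[e_ii, e_ab] = (delta_ia - delta_ib) e_ab] over [i] with weights [-i]. *)
Lemma deg_e (M : glmod F N) a b (x : M) :
  deg (gl_e a b x) = gl_e a b (deg x) + (b%:R - a%:R) *: gl_e a b x.
Proof.
have l := gl_linear (g := M) a b.
have E i : gl_e i i (gl_e a b x) = gl_e a b (gl_e i i x)
    + ((i == a)%:R - (b == i)%:R) *: gl_e a b x.
  apply/eqP; rewrite -subr_eq0 opprD addrA gl_bracket subr_eq0 scalerBl.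
  rewrite [i == b]eq_sym; apply/eqP; congr (_ - _).
  - by have [->|] := eqVneq i a; rewrite ?scale0r.
  - by have [->|] := eqVneq b i; rewrite ?scale0r.
rewrite /deg; under eq_bigr => i _ do rewrite E scalerDr.
rewrite big_split /= opprD -scaleN1r; congr (_ + _).
  rewrite scaleN1r -[in RHS]scaleN1r (linZ l) scaleN1r (linS l); congr (- _).
  by apply: eq_bigr => i _; rewrite (linZ l).
under eq_bigr => i _ do rewrite scalerA.
rewrite -scaler_suml -scaleNr; congr (_ *: _).
under eq_bigr => i _ do rewrite mulrBr.
rewrite sumrB opprB; congr (_ - _).
- rewrite (bigD1 b) //= eqxx mulr1 big1 ?addr0 // => i.
  by rewrite eq_sym => /negPf ->; rewrite mulr0.
- rewrite (bigD1 a) //= eqxx mulr1 big1 ?addr0 // => i /negPf ->.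
  by rewrite mulr0.
Qed.

Section HighestWeight.
Variable L : hwmod F N.
Local Notation v := (hw_vec L).

Definition topdeg : F := - \sum_(i < N) i%:R * (2 * hw_wt L i).

Lemma e_hw i : gl_e i i v = (2 * hw_wt L i) *: v.
Proof.
by rewrite -scalerA -hw_weight /gl_h scalerA divff ?scale1r ?(char0 1).
Qed.

Lemma deg_hw : deg v = topdeg *: v.
Proof.
rewrite /deg /topdeg scaleNr scaler_suml; congr (- _).
by apply: eq_bigr => i _; rewrite e_hw scalerA.
Qed.

Inductive lowered : L -> Prop :=
| lowered_hw : lowered v
| lowered_lin a x y : lowered x -> lowered y -> lowered (a *: x + y)
| lowered_e (i j : 'I_N) x : (j < i)%N -> lowered x -> lowered (gl_e i j x).

(** The lowered vectors form a submodule: moving a generator past a lowering operator leaves bracket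
    terms that the induction hypothesis covers. It contains [v], so irreducibility makes it
    everything. *)
Lemma loweredT x : lowered x.
Proof.
have l0 : lowered 0.
  by rewrite -(addNr v) -scaleN1r; apply: lowered_lin; apply: lowered_hw.
have lZ a y : lowered y -> lowered (a *: y).
  by move=> ly; rewrite -[_ *: _]addr0; apply: lowered_lin.
have le y : lowered y -> forall a b, lowered (gl_e a b y).
  elim=> {y} [|a' y z _ IHy _ IHz|i j y ji ly IH] a b.
  - have [ab|ba|/val_inj ab] := ltngtP a b.
    + by rewrite hw_raise.
    + by apply: lowered_e => //; apply: lowered_hw.
    + by rewrite ab e_hw; apply/lZ/lowered_hw.
  - by rewrite gl_linear; apply: lowered_lin.
  - rewrite -[gl_e a b _](subrK (gl_e i j (gl_e a b y))) gl_bracket.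
    rewrite -scaleNr -addrA; apply: (lowered_lin _ (IH _ _)).
    by apply: (lowered_lin _ (IH _ _)); apply: lowered_e.
case: (hw_irr (U := lowered)) => [|a b|h0|//].
- by split=> // c y w; apply: lowered_lin.
- by move=> y /le; apply.
by have /eqP := h0 _ lowered_hw; rewrite (negPf (hw_vec_neq0 L)).
Qed.

(** The top degree of [L] is spanned by [v], because every lowering operator strictly decreases the
    degree. *)
Lemma hw_below x : exists c y, below (@deg L) topdeg y /\ x = c *: v + y.
Proof.
have lD := @deg_linear L.
have be (i j : 'I_N) y : (j < i)%N -> below (@deg L) topdeg y ->
    below (@deg L) topdeg (gl_e i j y).
  move=> ji; elim=> {y} [a y z _ IHy _ IHz|k y Dy].
    by rewrite gl_linear; apply: below_lin.
  (* The eigenvalue drops by [i - j] from [top - k.+1]. *)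
  apply: (@below_eigen _ _ _ (k + (i - j))%N).
  rewrite deg_e Dy (linZ (gl_linear i j)) -scalerDl; congr (_ *: _).
  by rewrite -addSn natrD (natrB _ (ltnW ji)); ring.
elim: (loweredT x) => {x} [|a x y _ [c [x' [bx ->]]] _ [d [y' [by_ ->]]]|].
- by exists 1, 0; rewrite scale1r addr0; split=> //; apply: below0.
- exists (a * c + d), (a *: x' + y'); split; first exact: below_lin.
  by rewrite scalerDr scalerA scalerDl addrACA.
move=> i j x ji _ [c [y [by_ ->]]]; exists 0, (gl_e i j (c *: v + y)).
split; last by rewrite scale0r add0r.
rewrite gl_linear; apply: below_lin; last exact: be.
(* The eigenvalue drops from [top] to [top - (i - j)], and [i - j] is the successor of
   [i - j.+1]. *)
apply: (@below_eigen _ _ _ (i - j.+1)%N).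
rewrite deg_e deg_hw (linZ (gl_linear i j)) -scalerDl; congr (_ *: _).
by rewrite subnSK // (natrB _ (ltnW ji)); ring.
Qed.
End HighestWeight.

(** * The top degree of a product of two highest weight modules *)

Section TensorTop.
Variables L1 L2 : hwmod F N.
Local Notation v1 := (hw_vec L1).
Local Notation v2 := (hw_vec L2).

Definition deg2 (t : tens2 L1 L2) : tens2 L1 L2 :=
  at2l (@deg L1) t + at2r (@deg L2) t.

Lemma deg2_linear : linear deg2.
Proof.
move=> a x y; rewrite /deg2 (at2l_linear (@deg_linear L1)).
by rewrite (at2r_linear (@deg_linear L2)) scalerDr addrACA.
Qed.

Lemma deg2_pure a b (x : L1) (y : L2) : deg x = a *: x -> deg y = b *: y ->
  deg2 (tpure2 x y) = (a + b) *: tpure2 x y.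
Proof.
move=> Dx Dy; rewrite /deg2 at2l_pure ?at2r_pure; try exact: deg_linear.
rewrite Dx Dy (linZ (tpure2_linl (M1 := L1) (M2 := L2) y)).
by rewrite (linZ (tpure2_linr (M1 := L1) (M2 := L2) x)) scalerDl.
Qed.

Local Notation below2 := (below deg2 (topdeg L1 + topdeg L2)).

(** The case [m = 0] covers [y = v2]; positive [m] covers the eigenvectors below the top. *)
Lemma below_tensl x y m : below (@deg L1) (topdeg L1) x ->
  deg y = (topdeg L2 - m%:R) *: y -> below2 (tpure2 x y).
Proof.
move=> bx Dy; elim: bx => {x} [a x x' _ IH _ IH'|k x Dx].
  by rewrite (tpure2_linl (M1 := L1) (M2 := L2)); apply: below_lin.
apply: (@below_eigen _ _ _ (k + m)); rewrite (deg2_pure Dx Dy).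
by congr (_ *: _); rewrite -addSn natrD; ring.
Qed.

Lemma below_tensr x y m : below (@deg L2) (topdeg L2) y ->
  deg x = (topdeg L1 - m%:R) *: x -> below2 (tpure2 x y).
Proof.
move=> bx Dy; elim: bx => {y} [a y y' _ IH _ IH'|k y Dx].
  by rewrite (tpure2_linr (M1 := L1) (M2 := L2)); apply: below_lin.
apply: (@below_eigen _ _ _ (k + m)); rewrite (deg2_pure Dy Dx).
by congr (_ *: _); rewrite -addSn natrD; ring.
Qed.

Lemma below_tens x y : below (@deg L1) (topdeg L1) x ->
  below (@deg L2) (topdeg L2) y -> below2 (tpure2 x y).
Proof.
move=> bx; elim=> {y} [a y y' _ IH _ IH'|k y Dy]; last exact: below_tensl bx Dy.
by rewrite (tpure2_linr (M1 := L1) (M2 := L2)); apply: below_lin.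
Qed.

Lemma tens2_below (t : tens2 L1 L2) :
  exists c u, below2 u /\ t = c *: tpure2 v1 v2 + u.
Proof.
have l2 := deg2_linear.
rewrite (tens_sum t); elim: (trepr t) => [|[a w] s [c [u [bu IH]]]].
  by exists 0, 0; rewrite big_nil scale0r addr0; split=> //; apply: below0.
suff [d [u' [bu' E]]] : exists d u', below2 u' /\ tpure w = d *: tpure2 v1 v2 + u'.
  exists (a * d + c), (a *: u' + u); split; first exact: below_lin.
  by rewrite big_cons IH /= E scalerDr scalerA scalerDl addrACA.
rewrite -(pair2_eta w) -/(tpure2 _ _).
have [c1 [x [bx ->]]] := hw_below (w ord0 : L1).
have [c2 [y [by_ ->]]] := hw_below (w ord_max : L2).
(* In the expansion of [c1 v1 + x] tensor [c2 v2 + y] every term but the first has a factor below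
   the top. *)
exists (c1 * c2), (c1 *: tpure2 v1 y + (c2 *: tpure2 x v2 + tpure2 x y)).
have D1 : deg v1 = (topdeg L1 - 0%:R) *: v1 by rewrite subr0 deg_hw.
have D2 : deg v2 = (topdeg L2 - 0%:R) *: v2 by rewrite subr0 deg_hw.
split.
  apply: below_lin; first exact: below_tensr by_ D1.
  by apply: below_lin; [exact: below_tensl bx D2|exact: below_tens].
rewrite (tpure2_linl (M1 := L1) (M2 := L2)) !(tpure2_linr (M1 := L1) (M2 := L2)).
by rewrite scalerDr scalerA -!addrA.
Qed.

Lemma tens2_top t : deg2 t = (topdeg L1 + topdeg L2) *: t ->
  exists c, t = c *: tpure2 v1 v2.
Proof.
have [c [u [bu ->]]] := tens2_below t; move=> Dt; exists c.
have D0 := deg2_pure (deg_hw L1) (deg_hw L2).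
suff -> : u = 0 by rewrite addr0.
apply: (below_top deg2_linear bu); move: Dt; rewrite deg2_linear D0.
by rewrite scalerDr !scalerA [c * _]mulrC => /addrI.
Qed.

(** If the product vanished, the [x] whose product with [v2] is 0 would form a nonzero submodule,
    hence all of [L1]. The same argument in the second factor would then make every tensor zero. *)
Lemma tpure2_hw_neq0 : (exists t : tens2 L1 L2, t != 0) -> tpure2 v1 v2 != 0.
Proof.
move=> [t /negP t0]; apply/negP => /eqP v0; apply: t0; apply/eqP.
have lr x := tpure2_linr (M1 := L1) (M2 := L2) x.
have ll y := tpure2_linl (M1 := L1) (M2 := L2) y.
have h1 x : tpure2 x v2 = 0 :> tens2 L1 L2.
  case: (hw_irr (U := [set x : L1 | tpure2 x v2 = 0])) => [|i j y|h|h].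
  - split=> [|a x1 x2] /=; first by rewrite (lin0 (ll _)).
    by rewrite (ll v2) => -> ->; rewrite scaler0 addr0.
  - move=> /= y0; rewrite -at2l_pure ?y0; last exact: gl_linear.
    by rewrite (lin0 (at2l_linear (gl_linear i j))).
  - by have /eqP := h _ v0; rewrite (negPf (hw_vec_neq0 L1)).
  - exact: h.
have h2 y x : tpure2 x y = 0 :> tens2 L1 L2.
  move: y x; case: (hw_irr (U := [set y : L2 | forall x, tpure2 x y = 0 :> tens2 L1 L2]))
    => [|i j y|h|h].
  - split=> [x|a y1 y2 /= Y1 Y2 x] /=; first by rewrite (lin0 (lr _)).
    by rewrite (lr x) Y1 Y2 scaler0 addr0.
  - move=> /= y0 x; rewrite -at2r_pure ?y0; last exact: gl_linear.
    by rewrite (lin0 (at2r_linear (gl_linear i j))).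
  - by have /eqP := h _ h1; rewrite (negPf (hw_vec_neq0 L2)).
  - exact: h.
apply: (tens2_ext (f := id) (g := fun _ => 0)) => // a x y.
by rewrite scaler0 addr0.
Qed.
End TensorTop.

(** * Existence and bijectivity of the R-matrix *)

Section Rmat.
Variables L1 L2 : hwmod F N.
Local Notation v1 := (hw_vec L1).
Local Notation v2 := (hw_vec L2).

(** An isomorphism [f] preserves the degree, so it sends the product of highest weight vectors to a
    multiple [c] of the exchanged product. Injectivity gives [c != 0], and [f] divided by [c] is the
    normalized intertwiner. *)
Lemma is_Rmatrix_ex x y : generic L1 L2 x y ->
  exists A, is_Rmatrix (L1 := L1) (L2 := L2) (x - y) A.
Proof.
move=> [[ne1 _] [ne2 _] [f [[lf hf] [g fK _]]]].
have {}hf i j s t : f (T2 x y i j s t) = T2 y x i j s (f t) by rewrite -!yev2_T.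
have fD t : f (deg2 t) = deg2 (f t).
  (* The degree is a linear combination of the operators [T_ii^(1)], which [f] intertwines. *)
  have D M M' (u : tens2 M M') : at2l (@deg M) u + at2r (@deg M') u =
      - \sum_(i < N) i%:R *: (at2l (@gl_e _ _ M i i) u + at2r (@gl_e _ _ M' i i) u).
    move: u; apply: tens2_ext => [||a b].
    - move=> c u w; rewrite (at2l_linear (@deg_linear M)).
      by rewrite (at2r_linear (@deg_linear M')) scalerDr addrACA.
    - have l : linear (fun u : tens2 M M' => \sum_(i < N) i%:R *:
         (at2l (@gl_e _ _ M i i) u + at2r (@gl_e _ _ M' i i) u)).
        apply: lin_sum => i; apply: lin_comp; first exact: lin_scale.
        move=> c u w; rewrite (at2l_linear (@gl_linear _ _ M i i)).
        by rewrite (at2r_linear (@gl_linear _ _ M' i i)) scalerDr addrACA.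
      by move=> c u w; rewrite l opprD scalerN.
    rewrite at2l_pure ?at2r_pure; try exact: deg_linear.
    have -> : tpure2 (deg a) b = - \sum_(i < N) i%:R *: tpure2 (gl_e i i a) b.
      rewrite /deg -scaleN1r (linZ (tpure2_linl (M1 := M) (M2 := M') b)) scaleN1r.
      rewrite (linS (tpure2_linl (M1 := M) (M2 := M') b)); congr (- _).
      by apply: eq_bigr => i _; rewrite (linZ (tpure2_linl (M1 := M) (M2 := M') b)).
    have -> : tpure2 a (deg b) = - \sum_(i < N) i%:R *: tpure2 a (gl_e i i b).
      rewrite /deg -scaleN1r (linZ (tpure2_linr (M1 := M) (M2 := M') a)) scaleN1r.
      rewrite (linS (tpure2_linr (M1 := M) (M2 := M') a)); congr (- _).
      by apply: eq_bigr => i _; rewrite (linZ (tpure2_linr (M1 := M) (M2 := M') a)).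
    rewrite -opprD -big_split /=; congr (- _); apply: eq_bigr => i _.
    by rewrite -scalerDr at2l_pure ?at2r_pure //; apply: gl_linear.
  rewrite /deg2 !D -[LHS](@scale1r F) -scaleN1r (linZ lf) scale1r scaleN1r (linS lf).
  congr (- _); apply: eq_bigr => i _; rewrite (linZ lf).
  by have := hf i i 1%N t; rewrite !T2_1 => ->.
have D0 := deg2_pure (deg_hw L1) (deg_hw L2).
have [c fc] : exists c, f (tpure2 v1 v2) = c *: tpure2 v2 v1.
  by apply: tens2_top; rewrite -fD D0 (linZ lf) addrC.
have c0 : c != 0.
  apply: contraNneq (tpure2_hw_neq0 ne1) => c0; apply/eqP.
  by rewrite -[LHS]fK fc c0 scale0r -(lin0 lf) fK.
exists (fun t => flip (c^-1 *: f t)); split.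
- apply: lin_comp; first exact: flip_linear.
  by apply: lin_comp lf; apply: lin_scale.
- by rewrite flipK fc scalerA mulVf // scale1r.
move=> x' y' E _; split=> [a u w|i j s t]; rewrite !flipK.
  by rewrite lf scalerDr !scalerA mulrC.
have lT M M' a b i' j' s' : linear (@T2 F N M M' a b i' j' s').
  by move=> d u w; rewrite -!yev2_T y_linear.
rewrite !yev2_T (linZ (lT _ _ _ _ _ _ _)); congr (_ *: _).
(* Equal differences mean that both points move by the same amount [x' - x]. *)
have Ex : x' = x + (x' - x) by rewrite addrC subrK.
have Ey : y' = y + (x' - x) by rewrite -[x'](subrK y') E; ring.
by move: (x' - x) Ex Ey => d -> ->; apply: intertwine2_shift.
Qed.

(** Bijectivity is Schur's lemma: the kernel and the image of the intertwiner are submodules of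
    irreducible modules, and the highest weight product has nonzero image. *)
Lemma Rmatrix_generic x y : generic L1 L2 x y ->
  let A := Rmatrix (L1 := L1) (L2 := L2) (x - y) in
  [/\ linear A, bijective A
    & forall i j s t, flip (A (T2 x y i j s t)) = T2 y x i j s (flip (A t))].
Proof.
move=> gxy A; have [lA Av hA] : is_Rmatrix (x - y) A.
  exact: xgetPex (is_Rmatrix_ex gxy).
have [lf hf] := hA _ _ erefl gxy.
have [[ne1 ir1] [ne2 ir2] _] := gxy.
split=> // [|i j s t]; last by rewrite -!yev2_T hf.
have vv0 : tpure2 v2 v1 != 0 by apply: tpure2_hw_neq0.
have inj t : A t = 0 -> t = 0.
  case: (ir1 [set t | A t = 0]) => [|i j s w /= w0|h|h].
  - split=> [|a u w] /=; first exact: lin0 lA.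
    by rewrite lA => -> ->; rewrite scaler0 addr0.
  - apply: (can_inj (@flipK F N _ _)); rewrite hf w0.
    by rewrite (lin0 (@flip_linear _ _ _ _)) (lin0 (@y_linear _ _ _ _ _ _)).
  - exact: h.
  - by move: vv0; rewrite -Av h (lin0 (@flip_linear _ _ _ _)) eqxx.
have surj t : exists u, A u = t.
  suff [u fu] : exists u, flip (A u) = flip t.
    by exists u; apply: (can_inj (@flipK F N _ _)).
  case: (ir2 [set w | exists u, flip (A u) = w]) => [|i j s w [u <-]|h|h].
  - split=> [|a _ _ [u <-] [w <-]].
      by exists 0; rewrite (lin0 lA) (lin0 (@flip_linear _ _ _ _)).
    by exists (a *: u + w); rewrite lf.
  - by exists (@y_T _ _ (yev2 L1 L2 x y) i j s u); rewrite hf.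
  - by move: vv0; rewrite (h _ (ex_intro _ _ Av)) eqxx.
  - exact: h.
have [B BK] := boolp.choice surj.
exists B => // t; apply/eqP; rewrite -subr_eq0; apply/eqP/inj.
by rewrite (linB lA) BK subrr.
Qed.
End Rmat.
End Below.

(** * The cyclic move *)

Section TwistedPower.
Variables (F : fieldType) (V : lmodType F) (T X : V -> V) (S : set V).
Hypotheses (lT : linear T) (lX : linear X).
Hypotheses (ST : forall v, S v -> S (T v)) (SX : forall v, S v -> S (X v)).
Hypothesis XT : forall v, S v -> X (T v) - T (X v) = X (X v).

(** The product [(T + (a + 2 (k - 1)) X) ... (T + a X)]. The step 2 is the amount by which [T] and
    [X] raise [2 h_theta]. *)
Fixpoint twisted (a : F) k (v : V) : V :=
  if k is k'.+1 then
    T (twisted a k' v) + (a + 2 * k'%:R) *: X (twisted a k' v)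
  else v.

(** The falling factorial [b (b - 1) ... (b - i + 1)]. *)
Definition ffr (b : F) i : F := \prod_(q < i) (b - q%:R).

Lemma S_iter (f : V -> V) i v : (forall v, S v -> S (f v)) -> S v -> S (iter i f v).
Proof. by move=> Sf Sv; elim: i => //= i; apply: Sf. Qed.

(** Each of the [i] exchanges of [T] with an [X] costs one [X^(i+1)], by [XT]. *)
Lemma T_iter_X i v : S v ->
  T (iter i X v) = iter i X (T v) - i%:R *: iter i.+1 X v.
Proof.
move=> Sv; elim: i => [|i IH]; first by rewrite /= scale0r subr0.
have := XT (S_iter i SX Sv) => /eqP; rewrite subr_eq addrC -subr_eq => /eqP /= <-.
rewrite IH (linB lX) (linZ lX) -addrA -opprD; congr (_ - _).
by rewrite -[X in _ + X]scale1r -scalerDl natr1.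
Qed.

(* With T = d/dY and X = 1/Y, T + aX is the conjugate of T by Y^a. *)
Lemma twistedE a k v : S v -> twisted a k v =
  \sum_(i < k.+1) ('C(k, i)%:R * ffr (a + k%:R - 1) i) *:
     iter i X (iter (k - i) T v).
Proof.
move=> Sv; elim: k => [|k IH].
  by rewrite big_ord1 /= /ffr big_ord0 mulr1 scale1r.
have ST' j : S (iter j T v) by apply: S_iter.
rewrite /= IH (linS lT) (linS lX) scaler_sumr.
have E (i : 'I_k.+1) :
   T (('C(k, i)%:R * ffr (a + k%:R - 1) i) *: iter i X (iter (k - i) T v))
   = ('C(k, i)%:R * ffr (a + k%:R - 1) i) *: iter i X (iter (k.+1 - i) T v)
   - (i%:R * ('C(k, i)%:R * ffr (a + k%:R - 1) i)) *: iter i.+1 X (iter (k - i) T v).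
  rewrite (linZ lT) T_iter_X // scalerBr scalerA [_ * i%:R]mulrC.
  by rewrite subSn // -ltnS.
rewrite (eq_bigr _ (fun i _ => E i)).
under [X in _ + X]eq_bigr => i _ do rewrite (linZ lX) scalerA.
rewrite sumrB -addrA [X in _ + X]addrC -sumrB.
(* The first sum extends to [i = k + 1], where the binomial vanishes. The [- i] produced by
   [T_iter_X] joins the coefficient [a + 2 k] of [X]. *)
transitivity (\sum_(i < k.+2) ('C(k, i)%:R * ffr (a + k%:R - 1) i)
     *: iter i X (iter (k.+1 - i) T v) +
   \sum_(i < k.+1) ((a + 2 * k%:R - i%:R) * ('C(k, i)%:R * ffr (a + k%:R - 1) i))
     *: iter i.+1 X (iter (k - i) T v)).
  rewrite [in RHS]big_ord_recr /= bin_small // mul0r scale0r addr0; congr (_ + _).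
  by apply: eq_bigr => i _; rewrite -scalerBl -mulrBl.
rewrite big_ord_recl [RHS]big_ord_recl -addrA; congr (_ + _).
  by rewrite /ffr !big_ord0 !bin0.
rewrite -big_split; apply: eq_bigr => i _.
rewrite /bump /= ?add1n subSS -scalerDl; congr (_ *: _).
have ff1 : ffr (a + k%:R - 1) i.+1 = ffr (a + k%:R - 1) i * (a + k%:R - 1 - i%:R).
  by rewrite /ffr big_ord_recr.
have ff2 : ffr (a + k.+1%:R - 1) i.+1 = (a + k%:R) * ffr (a + k%:R - 1) i.
  rewrite /ffr big_ord_recl /= -(natr1 k); congr (_ * _); first by ring.
  by apply: eq_bigr => q _; rewrite /bump /= add1n -(natr1 q); ring.
have bin : 'C(k, i.+1)%:R * (i%:R + 1) = 'C(k, i)%:R * (k%:R - i%:R) :> F.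
  by rewrite natr1 -natrB 1?leq_ord // -!natrM mulnC mul_bin_left mulnC.
rewrite ff1 ff2 binS natrD; move: bin.
move: (ffr _ _) 'C(k, i.+1)%:R 'C(k, i)%:R => f c d bin.
(* This splitting isolates [c * (i + 1)], to which the binomial identity [bin] applies. *)
have -> : (c + d) * ((a + k%:R) * f) =
  (c * (i%:R + 1)) * f + c * (a + k%:R - 1 - i%:R) * f + d * (a + k%:R) * f by ring.
by rewrite bin; ring.
Qed.

(** At [a = 1 - k] the falling factorials start from [a + k - 1 = 0], so only the term [i = 0]
    survives. *)
Lemma twisted_iter k v : S v -> twisted (1 - k%:R) k v = iter k T v.
Proof.
move=> Sv; rewrite twistedE // big_ord_recl big1 ?addr0 => [|i _] /=.
  by rewrite subn0 bin0 /ffr big_ord0 mulr1 scale1r.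
rewrite /ffr big_ord_recl /= subrK subrr subr0 mul0r mulr0 scale0r //.
Qed.
End TwistedPower.

(** * Powers of e(z) on singular vectors under the cyclic move *)

Section CyclicShift.
Variables (F : fieldType) (r n : nat).
Local Notation N := r.+1.
Variable M : 'I_n -> glmod F N.
Local Notation word_T := (word_T (M := M)).
Local Notation E := (gl_tens_e (M := M)).
Local Notation max := (ord_max : 'I_N).
Local Notation zero := (ord0 : 'I_N).

Lemma word_at z s m (g : M m -> M m) i j q t : linear g -> m \notin s ->
  at_ M m g (word_T z s i j q t) = word_T z s i j q (at_ M m g t).
Proof.
move=> lg; elim: s i j q t => [|k s IH] i j q t /=.
  by case: q => [|q] _; rewrite /= ?(linZ (at_linear lg)) ?(lin0 (at_linear lg)).
rewrite inE negb_or => /andP[mk ms]; move: i j q t.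
apply: coprod_morph => [|*|*]; first exact: at_linear.
  by rewrite at_comm //; apply: ev_linear.
exact: IH.
Qed.

(** The defining relation at [r = 0], where [T^(0)] is scalar and one commutator vanishes. *)
Lemma word_gl_bracket z s a b i j q t : uniq s ->
  word_T z s b a 1 (word_T z s i j q t) - word_T z s i j q (word_T z s b a 1 t) =
  (b == j)%:R *: word_T z s i a q t - (i == a)%:R *: word_T z s b j q t.
Proof.
move=> us; have [lT _ rel] := word_action M z us.
have := rel b a i j 0%N q t.
rewrite !word0 (linZ (lT _ _ _)) subrr sub0r (linZ (lT _ _ _)) => /eqP.
by rewrite eqr_oppLR opprB => /eqP ->.
Qed.

Lemma at_gl_bracket m i j k l t :
  at_ M m (@gl_e _ _ (M m) i j) (at_ M m (@gl_e _ _ (M m) k l) t)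
  - at_ M m (@gl_e _ _ (M m) k l) (at_ M m (@gl_e _ _ (M m) i j) t) =
  (j == k)%:R *: at_ M m (@gl_e _ _ (M m) i l) t
  - (i == l)%:R *: at_ M m (@gl_e _ _ (M m) k j) t.
Proof.
have := @word_gl_bracket (fun=> 0) [:: m] i j l k 1 t erefl.
by rewrite !word1 !big_seq1 [l == i]eq_sym.
Qed.

(** Induction on [j - i] through [e_ij = [e_ik, e_kj]] with [k = i + 1]. *)
Lemma singular_lt (G : glmod F N) (t : G) : singular t ->
  forall i j : 'I_N, (i < j)%N -> gl_e i j t = 0.
Proof.
move=> st i j ij; have [d] := ubnP (j - i)%N.
elim: d i j ij => // d IH i j ij jid.
have [/st//|ji1] := eqVneq (j : nat) i.+1.
have i1j : (i.+1 < j)%N by rewrite ltn_neqAle eq_sym ji1.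
pose k : 'I_N := Ordinal (ltn_trans i1j (ltn_ord j)).
have := gl_bracket i k k j t; rewrite eqxx scale1r.
have -> : i == j = false by apply: contraTF ij => /eqP ->; rewrite ltnn.
rewrite scale0r subr0 => <-.
rewrite [gl_e i k t]st // (lin0 (gl_linear _ _)) subr0.
rewrite [gl_e k j t]IH ?(lin0 (gl_linear _ _)) //.
by rewrite /= subnSK.
Qed.

Definition word_e z s (t : tens M) : tens M :=
  word_T z s max zero 2 t - word_T z s max max 1 (word_T z s max zero 1 t).

Variables (r0 : (0 < r)%N) (p : F) (z : 'I_n -> F) (s : seq 'I_n) (m : 'I_n).
Hypothesis perm_s : perm_eq (m :: s) (enum 'I_n).

Let z' k := if k == m then z k + p else z k.
(** All operators below are expressed by the action [A] of the factors in [s] and the action [B] of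
    the factor [m], which commute. *)
Let A := word_T z s.
Let B i j := at_ M m (@gl_e _ _ (M m) i j).
Let X := B zero max.
Let T := word_T z (rcons s m) max zero 2.
Let T' := word_T z' (m :: s) max zero 2.
Let H t := E zero zero t - E max max t.

Let uniq_ms : uniq (m :: s).
Proof. by rewrite (perm_uniq perm_s) enum_uniq. Qed.
Let ms : m \notin s.
Proof. by case/andP: uniq_ms. Qed.
Let zero_max : (zero == max) = false.
Proof. by rewrite -val_eqE /= eq_sym -leqn0 leqNgt r0. Qed.
Let max_zero : (max == zero) = false.
Proof. by rewrite eq_sym zero_max. Qed.
Let lA i j q : linear (A i j q). Proof. exact: word_linear. Qed.
Let lB i j : linear (B i j). Proof. exact: at_gl_linear. Qed.
Let lE i j : linear (E i j). Proof. exact: gl_tens_linear. Qed.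
Let lT : linear T. Proof. exact: word_linear. Qed.
Let AB i j k l q t : B k l (A i j q t) = A i j q (B k l t).
Proof. by apply: word_at => //; apply: gl_linear. Qed.
Let BB i j k l t : B i j (B k l t) - B k l (B i j t) =
  (j == k)%:R *: B i l t - (i == l)%:R *: B k j t.
Proof. exact: at_gl_bracket. Qed.

Let lX : linear X. Proof. exact: lB. Qed.
Let XA i j q t : X (A i j q t) = A i j q (X t). Proof. exact: AB. Qed.
Let XB k t : X (B zero k t) - B zero k (X t) = - (zero == k)%:R *: X t.
Proof. by rewrite /X BB max_zero scale0r sub0r scaleNr. Qed.

Let EAB i j t : E i j t = A j i 1 t + B i j t.
Proof.
rewrite -(word1_gl z _ _ _ perm_s) /= coprod1 ?at_ev1 1?addrC // => *.
- exact: at_ev0.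
- exact: word0.
- exact: at_ev_linear.
Qed.

Let EB i j k l t : E i j (B k l t) = B k l (E i j t) +
  ((j == k)%:R *: B i l t - (i == l)%:R *: B k j t).
Proof.
by rewrite !EAB (linD (lB _ _)) AB -addrA -BB [B k l _ + _]addrC subrK.
Qed.

Let TE t : T t = A max zero 2 t + z m *: X t + \sum_k A max k 1 (B zero k t).
Proof.
rewrite /T -cats1 word_cat coprod2 => [|*|*|*].
- congr (_ + _ + _); first by rewrite /= coprod_counit ?at_evS //; exact: at_ev_linear.
  by apply: eq_bigr => k _; rewrite [word_T z [:: m] _ _ _ _]word1 big_seq1.
- exact: word0.
- exact: word0.
- exact: word_linear.
Qed.

Let T'E t : T' t = A max zero 2 t + (z m + p) *: X t
  + \sum_k B k max (A k zero 1 t).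
Proof.
rewrite /T' /= (@eq_word _ _ _ _ z' z s) => [|k ks]; last first.
  by rewrite /z'; case: eqP ms ks => [->|//] /negPf ->.
rewrite coprod2 => [|*|*|*].
- rewrite [X in X + _ = _]addrC at_evS /z' eqxx; congr (_ + _).
  by apply: eq_bigr => k _; rewrite at_ev1.
- exact: at_ev0.
- exact: word0.
- exact: at_ev_linear.
Qed.

Let sing (t : tens M) := singular (t : gl_tens M).

Let sing_E t (i j : 'I_N) : sing t -> (i < j)%N -> E i j t = 0.
Proof. by move=> st; exact: (@singular_lt (gl_tens M) t st). Qed.

(** A simple [e_ij] has neither [j] first nor [i] last, so both bracket terms with [e_1N] vanish. *)
Let singX t : sing t -> sing (X t).
Proof.
move=> st i j ij; rewrite /= -/(E i j _) /X EB (sing_E st) ?ij //.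
rewrite (lin0 (lB _ _)) add0r.
have -> : (j == zero) = false by apply/eqP => j0; rewrite j0 in ij.
have -> : (i == max) = false.
  by apply/eqP => i0; have := ltn_ord j; rewrite ij i0 ltnn.
by rewrite !scale0r subr0.
Qed.

Let uniq_sm : uniq (rcons s m). Proof. by rewrite rcons_uniq. Qed.
Let perm_sm : perm_eq (rcons s m) (enum 'I_n).
Proof. by rewrite perm_rcons. Qed.

Let ET i j t : E i j (T t) - T (E i j t) =
  (j == zero)%:R *: word_T z (rcons s m) max i 2 t
  - (max == i)%:R *: word_T z (rcons s m) j zero 2 t.
Proof.
by rewrite -!(word1_gl z _ _ _ perm_sm); apply: word_gl_bracket.
Qed.

Let singT t : sing t -> sing (T t).
Proof.
move=> st i j ij; rewrite /= -/(E i j _).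
have := ET i j t; rewrite (sing_E st) ?ij // (lin0 lT) subr0 => ->.
have -> : (j == zero) = false by apply/eqP => j0; rewrite j0 in ij.
have -> : (max == i) = false.
  by apply/eqP => i0; have := ltn_ord j; rewrite ij -i0 ltnn.
by rewrite !scale0r subr0.
Qed.

Let HT t : H (T t) = T (H t) + 2 *: T t.
Proof.
have := ET zero zero t; rewrite eqxx max_zero scale1r scale0r subr0 => /eqP.
rewrite subr_eq => /eqP E0.
have := ET max max t; rewrite eqxx max_zero scale1r scale0r sub0r => /eqP.
rewrite subr_eq => /eqP E1.
rewrite /H E0 E1 (linB lT) opprD opprK addrACA addrC.
by rewrite scaler_nat mulr2n.
Qed.

Let HX t : H (X t) = X (H t) + 2 *: X t.
Proof.
rewrite /H /X !EB !eqxx zero_max max_zero !scale1r !scale0r subr0 sub0r.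
rewrite (linB (lB _ _)) opprD opprK addrACA; congr (_ + _).
by rewrite scaler_nat mulr2n.
Qed.

(** Only the summand [k = zero] of [TE] fails to commute with [X], and it leaves
    [- A max zero 1 (X t)]. Since [X t] is singular, [A max zero 1] acts on it as [- X]. *)
Let XT t : sing t -> X (T t) - T (X t) = X (X t).
Proof.
move=> st; rewrite !TE !(linD lX) (linZ lX) XA opprD addrACA subrr add0r.
rewrite (linS lX) -sumrB.
under eq_bigr => k _ do rewrite XA -(linB (lA _ _ _)) XB (linZ (lA _ _ _)).
rewrite (bigD1 zero) //= big1 ?addr0 => [|k]; last first.
  by rewrite eq_sym => /negPf ->; rewrite oppr0 scale0r.
have := sing_E (singX st) (r0 : (zero < max)%N).
rewrite EAB => /eqP; rewrite addr_eq0 => /eqP ->.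
by rewrite scaleN1r opprK.
Qed.

(** The difference of [T'E] and [TE] is rewritten by [A = E - B]. Singularity leaves the two
    diagonal terms, which make up [X (H t)], and each of the [N] summands adds one commutator equal
    to [X t]. *)
Let T'_sing t : sing t -> T' t = T t + X (H t) + (p + N%:R) *: X t.
Proof.
move=> st; rewrite T'E TE scalerDl [X in X + _ = _]addrA.
have D : \sum_k B k max (A k zero 1 t) - \sum_k A max k 1 (B zero k t) =
    X (H t) + N%:R *: X t.
  rewrite -sumrB.
  have e k : B k max (A k zero 1 t) - A max k 1 (B zero k t) =
      (B k max (E zero k t) - B zero k (E k max t)) + X t.
    have <- : B zero k (B k max t) - B k max (B zero k t) = X t.
      by rewrite BB eqxx zero_max scale1r scale0r subr0.
    rewrite !EAB !(linD (lB _ _)) [B zero k (A _ _ _ _)]AB opprD.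
    by rewrite [X in _ = X + _]addrACA !addrA subrK addrK.
  under eq_bigr => k _ do rewrite e.
  rewrite big_split sumr_const card_ord scaler_nat; congr (_ + _).
  rewrite sumrB /H (linB lX); congr (_ - _).
  - rewrite (bigD1 zero) //= big1 ?addr0 // => k k0.
    by rewrite sing_E ?(lin0 (lB _ _)) // lt0n.
  - rewrite (bigD1 max) //= big1 ?addr0 // => k km.
    by rewrite sing_E ?(lin0 (lB _ _)) // ltn_neqAle -ltnS ltn_ord andbT.
move/eqP: D; rewrite subr_eq => /eqP ->.
rewrite scalerDl [X in _ + X = _]addrC addrACA [X in _ + X = _]addrCA.
by rewrite !addrA.
Qed.

Let e_sing z1 s1 t : perm_eq s1 (enum 'I_n) -> sing t ->
  word_e z1 s1 t = word_T z1 s1 max zero 2 t.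
Proof.
move=> ps st; rewrite /word_e [word_T z1 s1 max zero 1 t]word1_gl // sing_E //.
by rewrite (lin0 (word_linear _ _ _ _ _)) subr0.
Qed.

(** After [j] steps [2 h_theta] has eigenvalue [- (p + N + k - 1) + 2 j], so by [T'_sing] the new
    operator acts as [T + (1 - k + 2 j) X]. This is the next factor of [twisted] at [a = 1 - k], and
    [twisted_iter] concludes. *)
Lemma word_e_cycle k t : singular (t : gl_tens M) ->
  E zero zero t - E max max t = - (p + N%:R + k%:R - 1) *: t ->
  iter k (word_e (fun k => if k == m then z k + p else z k) (m :: s)) t =
  iter k (word_e z (rcons s m)) t.
Proof.
rewrite -/z' -/(sing t) -/(H t) => st Ht.
have -> : iter k (word_e z (rcons s m)) t = iter k T t.
  elim: k {Ht} => //= k ->; rewrite e_sing //.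
  by apply: (S_iter (S := sing)).
rewrite -(twisted_iter (S := sing) lT lX singT singX XT) //.
(* The number of steps becomes [j], while the [k] of the resonance stays fixed in [1 - k]. *)
move: {1 3}k => j.
suff [-> _] : [/\ iter j (word_e z' (m :: s)) t = twisted T X (1 - k%:R) j t,
   sing (twisted T X (1 - k%:R) j t) &
   H (twisted T X (1 - k%:R) j t) =
   (- (p + N%:R + k%:R - 1) + 2 * j%:R) *: twisted T X (1 - k%:R) j t] by [].
elim: j => [|j [IH1 IH2 IH3]]; first by rewrite /= mulr0 addr0; split.
move: IH1 IH2 IH3 => /=; move: (twisted _ _ _ _ _) => w -> sw Hw; split.
- rewrite e_sing // -/(T' w) T'_sing // Hw (linZ lX) -addrA -scalerDl.
  by congr (_ + _ *: _); ring.
- move=> a b ab; rewrite /= -/(E a b _) (linD (lE _ _)) (linZ (lE _ _)).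
  by rewrite !sing_E ?ab ?scaler0 ?addr0 //; [apply: singX|apply: singT].
- have lH : linear H.
    by move=> a u v; rewrite /H !lE scalerBr opprD addrACA.
  rewrite (linD lH) (linZ lH) HT HX Hw (linZ lT) (linZ lX) -!scalerDl.
  rewrite scalerA scalerDr scalerA; congr (_ *: _ + _ *: _); rewrite -natr1; ring.
Qed.
End CyclicShift.

(** * Conformal blocks *)

Section Permute.
Variables (F : fieldType) (N n : nat) (M : 'I_n -> glmod F N) (s : {perm 'I_n}).
Local Notation Ms := (fun k => M (s k)).
Local Notation tp := (@tpermute F N n M s).

(** [M (s (s^-1 k))] equals [M k] only propositionally, hence the transport. *)
Definition unpermute (w : forall k, Ms k) : forall k, M k :=
  fun k => eq_rect _ (fun j => M j : Type) (w (s^-1%g k)) k (permKV s k).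

Lemma unpermuteE w k : unpermute w (s k) = w k.
Proof.
rewrite /unpermute; move: (permKV s (s k)); rewrite permK => e.
by rewrite (eq_irrelevance e erefl).
Qed.

Lemma permute_ext (v v' : forall k, M k) : (forall k, v (s k) = v' (s k)) -> v = v'.
Proof.
move=> vv; apply: functional_extensionality_dep => k.
by rewrite -(permKV s k).
Qed.

Lemma permute_dfwith (v : forall k, M k) k (x : M (s k)) :
  (fun j => dfwith v x (s j)) = dfwith (T := Ms) (fun j => v (s j)) x.
Proof.
apply: functional_extensionality_dep => j.
have [<-|kj] := eqVneq k j; first by rewrite !dfwith_in.
by rewrite !dfwith_out // (inj_eq perm_inj).
Qed.

Lemma tpermute_bij : bijective tp.
Proof.
have ml : multilinear (fun w : forall k, Ms k => tpure (V := M) (unpermute w)).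
  move=> w k a x y.
  have E (u : Ms k) : unpermute (dfwith w u) = dfwith (T := M) (unpermute w) u.
    apply: permute_ext => j; rewrite unpermuteE.
    have [<-|kj] := eqVneq k j; first by rewrite !dfwith_in.
    by rewrite !dfwith_out ?(inj_eq perm_inj) // unpermuteE.
  by rewrite !E tpure_multilinear.
exists (tlift (fun w : forall k, Ms k => tpure (V := M) (unpermute w))).
  apply: (tens_ext (g := id)) => // [|v].
    exact: lin_comp (tlift_linear ml) (@tpermute_linear _ _ _ _ _).
  rewrite tpermute_pure (tlift_pure _ ml); congr tpure.
  by apply: permute_ext => k; rewrite unpermuteE.
apply: (tens_ext (g := id)) => // [|w].
  exact: lin_comp (@tpermute_linear _ _ _ _ _) (tlift_linear ml).
rewrite (tlift_pure _ ml) tpermute_pure; congr tpure.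
by apply: functional_extensionality_dep => k; rewrite unpermuteE.
Qed.

Lemma tpermute_at k (g : M (s k) -> M (s k)) t : linear g ->
  tp (at_ M (s k) g t) = at_ Ms k g (tp t).
Proof.
move=> lg; move: t; apply: tens_ext => [||v].
- exact: lin_comp (@tpermute_linear _ _ _ _ _) (at_linear lg).
- exact: lin_comp (at_linear (V := Ms) lg) (@tpermute_linear _ _ _ _ _).
by rewrite at_pure // !tpermute_pure at_pure // permute_dfwith.
Qed.

(** Place [k] of the permuted family holds the factor [s k], so the letters are relabelled by
    [s]. *)
Lemma tpermute_word z q i j e t : tp (word_T (M := M) z (map s q) i j e t) =
  word_T (M := Ms) (fun k => z (s k)) q i j e (tp t).
Proof.
have lp := @tpermute_linear F N n M s.
elim: q i j e t => [|k q IH] i j e t /=.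
  by case: e => [|e] /=; rewrite ?(linZ lp) ?(lin0 lp).
move: i j e t; apply: coprod_morph => // *.
by rewrite tpermute_at //; apply: ev_linear.
Qed.

Lemma tpermute_gl i j t :
  tp (gl_tens_e (M := M) i j t) = gl_tens_e (M := Ms) i j (tp t).
Proof.
rewrite -(word1_gl (M := Ms) (fun=> 0) _ _ _ (perm_refl _)).
rewrite -(word1_gl (M := M) (fun=> 0) (s := map s (enum 'I_n))) ?tpermute_word //.
apply: uniq_perm; rewrite ?(map_inj_uniq perm_inj) ?enum_uniq //.
move=> k; rewrite mem_enum; apply/mapP; exists (s^-1%g k); first by rewrite mem_enum.
by rewrite permKV.
Qed.
End Permute.

(** * Conformal blocks for an arbitrary order of the factors *)

Section Blocks.
Variables (F : fieldType) (char0 : forall k, k.+1%:R != 0 :> F) (r n : nat).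
Implicit Types L : 'I_n -> hwmod F r.+1.

(** The order [s] enters through [word_e] only; [sing_l] and [resonance] depend on the gl(N)-action
    alone. *)
Definition word_blocks L (p : F) (l : nat) z s : set (tens L) :=
  [set t | sing_l (L := L) l t /\
     forall k, (1 <= k <= l)%N -> resonance L p l k ->
       iter k (word_e z s) t = 0].

Arguments word_blocks : clear implicits.

Lemma conformal_blocks_word L p l z :
  conformal_blocks L p l z = word_blocks L p l z (enum 'I_n).
Proof. by []. Qed.

(** A bijection commuting with gl(N) matches singular weight spaces and resonances, and one
    intertwining the two operators [word_e] matches the kernels of their powers. *)
Lemma word_blocks_image L L' (K : tens L -> tens L') p l z z' s s' :
  linear K -> bijective K ->
  (forall i, tens_wt L i = tens_wt L' i) ->
  (forall i j t, K (gl_tens_e (M := L) i j t) = gl_tens_e (M := L') i j (K t)) ->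
  (forall t, K (word_e z s t) = word_e z' s' (K t)) ->
  K @` word_blocks L p l z s = word_blocks L' p l z' s'.
Proof.
move=> lK [J KJ JK] wt Kgl Ke.
have inj0 t : K t = 0 -> t = 0 by move=> Kt; rewrite -(KJ t) Kt -(lin0 lK) KJ.
have Kh t : h_theta (M := gl_tens L') (K t) = K (h_theta (M := gl_tens L) t).
  by rewrite /h_theta /gl_h (linB lK) !(linZ lK) /= !Kgl.
have Ksing t : sing_l (L := L') l (K t) <-> sing_l (L := L) l t.
  split=> -[st ht]; split.
  - move=> i j ij; apply: inj0; rewrite /= Kgl; exact: st.
  - by apply: (can_inj KJ); rewrite -Kh ht (linZ lK) !wt.
  - by move=> i j ij; rewrite /= -Kgl -[RHS](lin0 lK); congr K; apply: st.
  - by rewrite Kh ht (linZ lK) !wt.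
have Kres k : resonance L p l k <-> resonance L' p l k.
  split=> res t st.
  - have /res : sing_l (L := L) l (J t) by apply/Ksing; rewrite JK.
    by move/(congr1 K); rewrite (linD lK) !(linZ lK) -Kh JK (lin0 lK).
  - apply: inj0; rewrite (linD lK) !(linZ lK) -Kh; exact/res/Ksing.
have Kiter k t : K (iter k (word_e z s) t) = iter k (word_e z' s') (K t).
  by elim: k => //= k <-.
apply/seteqP; split=> [_ [t [st h] <-]|t [st h]].
  split=> [|k kl res]; first exact/Ksing.
  by rewrite -Kiter h ?(lin0 lK) //; apply/Kres.
exists (J t) => //; split=> [|k kl res]; first by apply/Ksing; rewrite JK.
by apply: inj0; rewrite Kiter JK h //; apply/Kres.
Qed.

Lemma act2_bij L (i j : 'I_n) (A : tens2 (L i) (L j) -> tens2 (L i) (L j)) :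
  i != j -> linear A -> bijective A -> bijective (act2 (M := L) A).
Proof.
move=> ij lA [B AB BA].
have lB : linear B by move=> a x y; apply: (can_inj AB); rewrite lA !BA.
have can (C D : tens2 (L i) (L j) -> tens2 (L i) (L j)) : linear C -> linear D ->
    cancel C D -> cancel (act2 (M := L) C) (act2 (M := L) D).
  move=> lC lD CD; apply: (tens_ext (g := id)) => // [|v].
    exact: lin_comp (act2_linear ij lD) (act2_linear ij lC).
  by rewrite -{1}(ins2_id ij v) !act2_ins2 // CD ins2_id.
by exists (act2 (M := L) B); apply: can.
Qed.

Lemma uniq_pair (i j : 'I_n) s1 s2 : uniq (s1 ++ [:: i, j & s2]) ->
  [/\ i != j, i \notin s1 ++ s2 & j \notin s1 ++ s2].
Proof.
rewrite (perm_uniq (s2 := [:: i, j & s1 ++ s2])); last first.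
  by rewrite perm_catC -[[:: i, j & s2]]/([:: i; j] ++ s2) -catA !perm_cons perm_catC.
by case/and3P; rewrite inE negb_or => /andP[].
Qed.

Lemma R_at_linear L i j z : i != j -> generic (L i) (L j) (z i) (z j) ->
  linear (R_at L i j (z i - z j)).
Proof. by move=> ij /(Rmatrix_generic char0)[lA _ _]; apply: act2_linear. Qed.

Lemma R_at_bij L i j z : i != j -> generic (L i) (L j) (z i) (z j) ->
  bijective (R_at L i j (z i - z j)).
Proof. by move=> ij /(Rmatrix_generic char0)[lA bA _]; apply: act2_bij. Qed.

Lemma R_at_word L i j z s1 s2 a b e t :
  uniq (s1 ++ [:: i, j & s2]) -> generic (L i) (L j) (z i) (z j) ->
  R_at L i j (z i - z j) (word_T (M := L) z (s1 ++ [:: i, j & s2]) a b e t) =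
  word_T (M := L) z (s1 ++ [:: j, i & s2]) a b e (R_at L i j (z i - z j) t).
Proof.
move=> /uniq_pair[ij i12 j12] /(Rmatrix_generic char0)[lA bA hA].
by apply: act2_word.
Qed.

Lemma swap_perm (i j : 'I_n) s1 s2 :
  perm_eq (s1 ++ [:: i, j & s2]) (s1 ++ [:: j, i & s2]).
Proof. by rewrite perm_cat2l; apply/permPl/(perm_catCA [:: i] [:: j]). Qed.

(** The gl(N)-action is [T^(1)] in any order of the factors, so an order starting with [i, j] is
    chosen. *)
Lemma R_at_gl L i j z a b t : i != j ->
  generic (L i) (L j) (z i) (z j) ->
  R_at L i j (z i - z j) (gl_tens_e (M := L) a b t) =
  gl_tens_e (M := L) a b (R_at L i j (z i - z j) t).
Proof.
move=> ij gij; set s := rem j (rem i (enum 'I_n)).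
have ps : perm_eq [:: i, j & s] (enum 'I_n).
  rewrite perm_sym; apply: (perm_trans (perm_to_rem (x := i) _)).
    by rewrite mem_enum.
  rewrite perm_cons; apply: perm_to_rem.
  by rewrite mem_rem_uniq ?enum_uniq // !inE eq_sym ij mem_enum.
have us : uniq ([::] ++ [:: i, j & s]) by rewrite (perm_uniq ps) enum_uniq.
have := R_at_word b a 1 t us gij.
by rewrite !(word1_gl (M := L)) // -(permPl (swap_perm i j [::] s)).
Qed.

Lemma word_blocks_R L p l i j z s1 s2 :
  uniq (s1 ++ [:: i, j & s2]) -> generic (L i) (L j) (z i) (z j) ->
  R_at L i j (z i - z j) @` word_blocks L p l z (s1 ++ [:: i, j & s2]) =
  word_blocks L p l z (s1 ++ [:: j, i & s2]).
Proof.
move=> us gij; have [ij _ _] := uniq_pair us.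
have lR := R_at_linear ij gij.
apply: word_blocks_image => // [|a b t|t]; first exact: R_at_bij.
  exact: R_at_gl.
by rewrite /word_e (linB lR) !R_at_word.
Qed.

(** Resonance prescribes exactly the eigenvalue of [2 h_theta] at which [word_e_cycle] equates the
    [k]-th powers. *)
Lemma word_blocks_cycle L p l z s m : perm_eq (m :: s) (enum 'I_n) ->
  word_blocks L p l z (rcons s m) =
  word_blocks L p l (fun k => if k == m then z k + p else z k) (m :: s).
Proof.
move=> ps; have two0 : 2 != 0 :> F := char0 1.
suff iterE t k : sing_l (L := L) l t -> (1 <= k <= l)%N -> resonance L p l k ->
    iter k (word_e z (rcons s m)) t =
    iter k (word_e (fun k => if k == m then z k + p else z k) (m :: s)) t.
  apply/seteqP; split=> t [st h]; split=> // k kl res.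
    by rewrite -iterE ?h.
  by rewrite iterE ?h.
(* For [N = 1] the operator [h_theta] is zero while [1 <= k <= l] forces [l != 0], so [sing_l]
   contains only 0. *)
move=> st kl res; have [r0|r0] := posnP r.
  suff -> : t = 0.
    have e0 z1 s1 : iter k (word_e (M := L) z1 s1) 0 = 0.
      elim: (k) => //= k' ->.
      by rewrite /word_e !(lin0 (word_linear _ _ _ _ _)) subr0.
    by rewrite !e0.
  have [_] := st; have -> : ord_max = ord0 :> 'I_r.+1 by apply/val_inj; rewrite /= r0.
  rewrite subrr sub0r => /eqP; rewrite /h_theta.
  have -> : ord_max = ord0 :> 'I_r.+1 by apply/val_inj; rewrite /= r0.
  rewrite subrr eq_sym scaler_eq0 oppr_eq0 => /orP[|/eqP//].
  by case/andP: kl => k1 /(leq_trans k1) /prednK <-; rewrite (negPf (char0 _)).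
have [sgt _] := st; rewrite word_e_cycle //.
have := res _ st; rewrite /h_theta /gl_h -scalerBr scalerA divff // scale1r.
by move/eqP; rewrite addr_eq0 -scaleNr => /eqP.
Qed.
End Blocks.
Arguments word_blocks {F r n} L p l z s _.

(** * Splitting the increasing list of factors *)

Section EnumOrd.
Variable n : nat.
Let lt (i j : 'I_n) := (i < j)%N.

Let ltT : transitive lt.
Proof. by move=> i j k; apply: ltn_trans. Qed.

Let eq_enum s : sorted lt s -> (forall k, k \in s) -> enum 'I_n = s.
Proof.
move=> ss alls; apply: (irr_sorted_eq ltT) => // [i||i].
- exact: ltnn.
- have := iota_ltn_sorted 0 n; rewrite -val_enum_ord sorted_map.
  by apply: sub_sorted.
- by rewrite mem_enum alls.
Qed.

Let enum_pairwise : pairwise lt (enum 'I_n).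
Proof.
rewrite -sorted_pairwise //; have := iota_ltn_sorted 0 n.
by rewrite -val_enum_ord sorted_map.
Qed.

Let mem_fenum (P : pred 'I_n) k : (k \in [seq j <- enum 'I_n | P j]) = P k.
Proof. by rewrite mem_filter mem_enum andbT. Qed.

Lemma enum_ord_split (m : 'I_n) : enum 'I_n =
  [seq j : 'I_n <- enum 'I_n | (j < m)%N] ++
  m :: [seq j : 'I_n <- enum 'I_n | (m < j)%N].
Proof.
apply: eq_enum => [|k].
  rewrite sorted_pairwise // pairwise_cat pairwise_cons allrel_consr -andbA.
  apply/and5P; split; try exact: pairwise_filter.
  - by apply/allP => k; rewrite mem_fenum.
  - apply/allrelP => a b; rewrite !mem_fenum; apply: ltn_trans.
  - by apply/allP => k; rewrite mem_fenum.
rewrite mem_cat inE !mem_fenum.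
by rewrite -val_eqE; case: ltngtP.
Qed.

Lemma enum_ord_split2 (i j : 'I_n) : j = i.+1 :> nat -> enum 'I_n =
  [seq k : 'I_n <- enum 'I_n | (k < i)%N] ++
  [:: i, j & [seq k : 'I_n <- enum 'I_n | (j < k)%N]].
Proof.
move=> ij; rewrite {1}(enum_ord_split i); congr (_ ++ _ :: _).
apply: (irr_sorted_eq ltT) => [k|||k]; first exact: ltnn.
- by rewrite sorted_pairwise // pairwise_filter.
- rewrite sorted_pairwise //= pairwise_filter // andbT.
  by apply/allP => k; rewrite mem_fenum.
rewrite !inE !mem_fenum ij -val_eqE /= ij.
by rewrite [(i < k)%N]leq_eqVlt eq_sym.
Qed.
End EnumOrd.

(** * Invariance under the qKZ operators and under exchanges *)

Section MoveFactor.
Variables (F : fieldType) (char0 : forall k, k.+1%:R != 0 :> F) (r n : nat).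
Variables (L : 'I_n -> hwmod F r.+1) (p : F) (l : nat).

(** The letter [m] passes those of [s2] one by one. The argument [u] is kept separate because [qKZ]
    also uses [z m - z j + p], a difference of points only after the shift. *)
Lemma word_blocks_foldl z (u : 'I_n -> F) m s1 s2 s3 :
  uniq (s1 ++ m :: s2 ++ s3) ->
  {in s2, forall j, u j = z m - z j /\ generic (L m) (L j) (z m) (z j)} ->
  (fun t => foldl (fun x j => R_at L m j (u j) x) t s2) @`
    word_blocks L p l z (s1 ++ m :: s2 ++ s3) =
  word_blocks L p l z (s1 ++ s2 ++ m :: s3).
Proof.
elim: s2 s1 => [|j s2 IH] s1 us hs /=; first by rewrite image_id.
have [uj gj] := hs j (mem_head _ _).
rewrite -(image_comp (R_at L m j (u j)) (fun t => foldl _ t s2)) uj.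
rewrite (word_blocks_R char0) //.
have := IH (rcons s1 j); rewrite !cat_rcons; apply.
  by rewrite -(perm_uniq (swap_perm _ _ _ _)).
by move=> k ks; apply: hs; rewrite inE ks orbT.
Qed.

(** The word runs through [s1 m s2], [s1 s2 m], [m s1 s2] and back to [s1 m s2]; the points change
    from [z] to [z'] at the middle move. *)
Lemma conformal_blocks_qKZ z (i : 'I_n) :
  (forall j : 'I_n, (i < j)%N -> generic (L i) (L j) (z i) (z j)) ->
  (forall j : 'I_n, (j < i)%N -> generic (L i) (L j) (z i + p) (z j)) ->
  qKZ L p i z @` conformal_blocks L p l z =
  conformal_blocks L p l (fun k => if k == i then z k + p else z k).
Proof.
move=> gt_i lt_i; rewrite !conformal_blocks_word /qKZ.
have := enum_uniq 'I_n; have eE := enum_ord_split i.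
have in1 j : j \in [seq j : 'I_n <- enum 'I_n | (j < i)%N] -> (j < i)%N.
  by rewrite mem_filter => /andP[].
have in2 j : j \in [seq j : 'I_n <- enum 'I_n | (i < j)%N] -> (i < j)%N.
  by rewrite mem_filter => /andP[].
set s1 := [seq j : 'I_n <- _ | (j < i)%N] in eE in1 *.
set s2 := [seq j : 'I_n <- _ | (i < j)%N] in eE in2 *.
set z' := fun k => if k == i then z k + p else z k.
have pE : perm_eq (i :: s1 ++ s2) (enum 'I_n).
  by rewrite eE; apply/permPl/(perm_catCA [:: i] s1).
move=> uE; have us : uniq (i :: s1 ++ s2) by rewrite (perm_uniq pE).
rewrite eE in uE *.
rewrite -(image_comp (fun t => foldl (fun x j => R_at L i j (z i - z j) x) t s2)
   (fun t => foldl (fun x j => R_at L i j (z i - z j + p) x) t s1)).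
have H1 := @word_blocks_foldl z (fun j => z i - z j) i s1 s2 [::].
rewrite cats0 in H1; rewrite H1 => [|//|j /in2 ij]; last by split=> //; apply: gt_i.
rewrite catA cats1 (word_blocks_cycle char0) // -/z'.
apply: (@word_blocks_foldl z' (fun j => z i - z j + p) i [::] s1 s2) => // j /in1 ji.
have ji' : j == i = false by apply/eqP => e; rewrite e ltnn in ji.
rewrite /z' eqxx ji'; split; last exact: lt_i.
by rewrite addrAC.
Qed.

Lemma conformal_blocks_swap z (i j : 'I_n) : j = i.+1 :> nat ->
  generic (L i) (L j) (z i) (z j) ->
  (fun t => tpermute (M := L) (tperm i j) (R_at L i j (z i - z j) t)) @`
    conformal_blocks L p l z =
  conformal_blocks (fun k => L (tperm i j k)) p l (fun k => z (tperm i j k)).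
Proof.
move=> ij gij; rewrite !conformal_blocks_word.
rewrite -(image_comp (R_at L i j (z i - z j)) (tpermute (M := L) (tperm i j))).
have eE := enum_ord_split2 ij.
have in1 k : k \in [seq k : 'I_n <- enum 'I_n | (k < i)%N] -> (k < i)%N.
  by rewrite mem_filter => /andP[].
have in2 k : k \in [seq k : 'I_n <- enum 'I_n | (j < k)%N] -> (j < k)%N.
  by rewrite mem_filter => /andP[].
set s1 := [seq k : 'I_n <- _ | (k < i)%N] in eE in1.
set s2 := [seq k : 'I_n <- _ | (j < k)%N] in eE in2.
have fix_out s : {in s, forall k : 'I_n, (k < i)%N || (j < k)%N} -> map (tperm i j) s = s.
  move=> hs; apply: map_id_in => k /hs ks; apply: tpermD.
  - by apply: contraTneq ks => <-; rewrite ltnn ij ltnNge leqnSn.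
  - by apply: contraTneq ks => <-; rewrite ltnn ij ltnNge leqnSn.
(* Relabelling by the transposition turns the standard order into the word left by the R-matrix, so
   [tpermute_word] brings back the standard order for the permuted family. *)
have mE : map (tperm i j) (enum 'I_n) = s1 ++ [:: j, i & s2].
  rewrite eE map_cat /= tpermL tpermR !fix_out // => k.
  - by move/in2 => ->; rewrite orbT.
  - by move/in1 => ->.
rewrite {1}eE (word_blocks_R char0) //; last by rewrite -eE enum_uniq.
rewrite -mE; apply: word_blocks_image.
- exact: tpermute_linear.
- exact: tpermute_bij.
- by move=> k; rewrite /tens_wt (reindex_inj (@perm_inj _ (tperm i j))).
- exact: tpermute_gl.
- by move=> t; rewrite /word_e (linB (@tpermute_linear _ _ _ _ _)) !tpermute_word.
Qed.
End MoveFactor.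

Theorem theorem2 (R : realType) (r n : nat) (p : R[i]) (hp : p != 0)
    (L : 'I_n -> hwmod R[i] r.+1) (l : nat) :
  (forall (z : 'I_n -> R[i]) (i : 'I_n),
     (forall j : 'I_n, (i < j)%N -> generic (L i) (L j) (z i) (z j)) ->
     (forall j : 'I_n, (j < i)%N -> generic (L i) (L j) (z i + p) (z j)) ->
     qKZ L p i z @` conformal_blocks L p l z
     = conformal_blocks L p l (fun k => if k == i then z k + p else z k))
  /\
  (forall (z : 'I_n -> R[i]) (i j : 'I_n),
     j = i.+1 :> nat ->
     generic (L i) (L j) (z i) (z j) ->
     (fun t => tpermute (tperm i j) (R_at L i j (z i - z j) t))
       @` conformal_blocks L p l z
     = conformal_blocks (fun k => L (tperm i j k)) p l
         (fun k => z (tperm i j k))).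
Proof.
have char0 k : k.+1%:R != 0 :> R[i] by rewrite pnatr_eq0.
by split=> z i; [apply: conformal_blocks_qKZ|apply: conformal_blocks_swap].
Qed.
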